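(* Let $p,q$ be nonnegative integers, let $\kappa_1,\dots,\kappa_p,\mu_1,\dots,\mu_q$ be complex numbers none of which is in $\{0,-1,-2,\dots\}$, let $\alpha,\beta\in\mathbb{C}$ with $\Re(\alpha)>0$, let $\lambda_2,\lambda_3\in\mathbb{C}$ with $\Re(\lambda_3)>\Re(\lambda_2)>0$, let $\omega,w\in\mathbb{C}$ with $\Re(\omega)>0$, $\Re(w)>0$, and let $z\in\mathbb{C}$. Then the beta transform in $\rho$ of the M-confluent hypergeometric function is $$\begin{aligned}&\int_0^1\rho^{\omega-1}(1-\rho)^{w-1}\;{}^{M}\Phi_{p,q}^{(\alpha,\beta)}(\kappa_1,\dots,\kappa_p;\mu_1,\dots,\mu_q;\lambda_{2};\lambda_{3};z;\rho)\,d\rho\\ &\qquad=B(\omega,w)\;{}^{M}\Phi_{p+1,q+1}^{(\alpha,\beta)}\left(\kappa_{1},\ldots,\kappa_p,\omega;\mu_1,\ldots,\mu_q,\omega+w;\lambda_{2};\lambda_{3};z;1\right).\end{aligned}$$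
   Context: $(\lambda)_m=\Gamma(\lambda+m)/\Gamma(\lambda)$, $(\lambda)_0=1$ is the Pochhammer symbol and $B(x,y)=\int_0^1 t^{x-1}(1-t)^{y-1}dt$ is the classical beta function. The generalized M-series is $${}_{p}^{\alpha}M^{\beta}_{q}(\kappa_{1},\ldots,\kappa_{p};\mu_{1},\ldots,\mu_{q};z)=\sum_{m=0}^{\infty}\frac{(\kappa_{1})_{m}\cdots(\kappa_p)_{m}}{(\mu_1)_{m}\cdots(\mu_q)_{m}}\frac{z^{m}}{\Gamma(\alpha m+\beta)}.$$ The modified beta (M-beta) and modified confluent hypergeometric (M-confluent hypergeometric) functions are $${}^{M}B_{p,q}^{(\alpha,\beta)}(\kappa_{1},\ldots,\kappa_p;\mu_1,\ldots,\mu_q;x,y;\rho)=\int_{0}^{1}t^{x-1}(1-t)^{y-1}\,{}_{p}^{\alpha}M^{\beta}_{q}\left(\kappa_{1},\ldots,\kappa_{p};\mu_{1},\ldots,\mu_{q};\frac{-\rho}{t(1-t)}\right) dt,$$ $${}^{M}\Phi_{p,q}^{(\alpha,\beta)}(\kappa_{1},\ldots,\kappa_p;\mu_1,\ldots,\mu_q;\lambda_{2};\lambda_{3};z;\rho)=\sum_{n=0}^{\infty}\frac{{}^{M}B_{p,q}^{(\alpha,\beta)}(\kappa_{1},\ldots,\kappa_p;\mu_1,\ldots,\mu_q;\lambda_{2}+n,\lambda_{3}-\lambda_{2};\rho)}{B(\lambda_{2},\lambda_{3}-\lambda_{2})}\frac{z^{n}}{n!}.$$ These functions are defined for those parameters and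 arguments for which the series and integrals converge. *)

(* Defs.v *)
From mathcomp Require Import all_boot all_order all_algebra.
From mathcomp Require Import complex.
From mathcomp Require Import all_classical all_reals all_analysis.

Set Implicit Arguments.
Unset Strict Implicit.
Unset Printing Implicit Defensive.

Import Order.TTheory GRing.Theory Num.Theory.
Import numFieldNormedType.Exports.

Local Open Scope classical_set_scope.
Local Open Scope ring_scope.
Local Open Scope complex_scope.

(* [R[i]^o] is the field of complex numbers with the topology of its modulus. *)
Definition csummable (R : realType) (u : nat -> R[i]) : Prop :=
  cvgn (series (u : nat -> R[i]^o)).

Definition csum (R : realType) (u : nat -> R[i]) : R[i] :=
  limn (series (u : nat -> R[i]^o)).

(* Integrals over ]0, 1[ are (absolutely convergent) Lebesgue integrals, taken
   on the real and imaginary parts. *)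
Definition cintegrable01 (R : realType) (f : R -> R[i]) : Prop :=
  (@lebesgue_measure R).-integrable `]0, 1[ (fun t => (complex.Re (f t))%:E) /\
  (@lebesgue_measure R).-integrable `]0, 1[ (fun t => (complex.Im (f t))%:E).

Definition cint01 (R : realType) (f : R -> R[i]) : R[i] :=
  Rintegral (@lebesgue_measure R) `]0, 1[ (fun t => complex.Re (f t)) +i*
  Rintegral (@lebesgue_measure R) `]0, 1[ (fun t => complex.Im (f t)).

Definition cexp (R : realType) (z : R[i]) : R[i] :=
  (expR (complex.Re z))%:C * (cos (complex.Im z) +i* sin (complex.Im z)).

(* t ^ z, only meaningful for t > 0 *)
Definition cpow (R : realType) (t : R) (z : R[i]) : R[i] :=
  cexp (z * (ln t)%:C).

(* Gauss' formula
     Gamma(z) = lim_n  n! n^z / (z (z+1) ... (z+n)),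
   valid on the whole domain of Gamma. At a pole, inversion in [R[i]] being
   total with 0^-1 = 0, the sequence is eventually 0; so cgamma z = 0 and
   (cgamma z)^-1 = 0, which is the value there of the entire function
   1/Gamma. *)
Definition cgamma (R : realType) (z : R[i]) : R[i] :=
  limn ((fun n : nat =>
    (n`!)%:R * cpow n%:R z / \prod_(k < n.+1) (z + (k : nat)%:R))
    : nat -> R[i]^o).

Definition pochhammer (R : realType) (l : R[i]) (m : nat) : R[i] :=
  if m is 0%N then 1 else cgamma (l + m%:R) / cgamma l.

(* Used for Re x > 0 and Re y > 0 only, where the integral converges. *)
Definition cbeta (R : realType) (x y : R[i]) : R[i] :=
  cint01 (fun t : R => cpow t (x - 1) * cpow (1 - t) (y - 1)).

Definition mseries_term (R : realType) (alpha beta : R[i])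
    (kappa mu : seq R[i]) (z : R[i]) (m : nat) : R[i] :=
  (\prod_(k <- kappa) pochhammer k m) / (\prod_(k <- mu) pochhammer k m)
  * (z ^+ m / cgamma (alpha * m%:R + beta)).

Definition mseries_defined (R : realType) (alpha beta : R[i])
    (kappa mu : seq R[i]) (z : R[i]) : Prop :=
  csummable (mseries_term alpha beta kappa mu z).

Definition mseries (R : realType) (alpha beta : R[i])
    (kappa mu : seq R[i]) (z : R[i]) : R[i] :=
  csum (mseries_term alpha beta kappa mu z).

Definition mbeta_integrand (R : realType) (alpha beta : R[i])
    (kappa mu : seq R[i]) (x y rho : R[i]) (t : R) : R[i] :=
  cpow t (x - 1) * cpow (1 - t) (y - 1)
  * mseries alpha beta kappa mu (- rho / (t * (1 - t))%:C).

Definition mbeta_defined (R : realType) (alpha beta : R[i])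
    (kappa mu : seq R[i]) (x y rho : R[i]) : Prop :=
  (forall t : R, 0 < t < 1 ->
     mseries_defined alpha beta kappa mu (- rho / (t * (1 - t))%:C)) /\
  cintegrable01 (mbeta_integrand alpha beta kappa mu x y rho).

Definition mbeta (R : realType) (alpha beta : R[i])
    (kappa mu : seq R[i]) (x y rho : R[i]) : R[i] :=
  cint01 (mbeta_integrand alpha beta kappa mu x y rho).

Definition mphi_term (R : realType) (alpha beta : R[i])
    (kappa mu : seq R[i]) (l2 l3 z rho : R[i]) (n : nat) : R[i] :=
  mbeta alpha beta kappa mu (l2 + n%:R) (l3 - l2) rho / cbeta l2 (l3 - l2)
  * (z ^+ n / (n`!)%:R).

Definition mphi_defined (R : realType) (alpha beta : R[i])
    (kappa mu : seq R[i]) (l2 l3 z rho : R[i]) : Prop :=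
  (forall n : nat,
     mbeta_defined alpha beta kappa mu (l2 + n%:R) (l3 - l2) rho) /\
  csummable (mphi_term alpha beta kappa mu l2 l3 z rho).

Definition mphi (R : realType) (alpha beta : R[i])
    (kappa mu : seq R[i]) (l2 l3 z rho : R[i]) : R[i] :=
  csum (mphi_term alpha beta kappa mu l2 l3 z rho).

(* Main.v *)
(** Write the M-series at [- s] as [f s], the sum of the [a m * (- s) ^ m].
  Because [t (1 - t)] takes arbitrarily small values, convergence at one [rho]
  makes [f] entire, whatever the parameters. Integrating [f (r s)] against
  [r ^ (omega - 1) (1 - r) ^ (w - 1)] term by term multiplies [a m] by
  [B (omega + m, w) = B (omega, w) (omega)_m / (omega + w)_m], which is the
  coefficient of the extended M-series. It remains to exchange the beta
  transform with the integral over [t] and with the sum over [n]. Both follow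
  from a bound, uniform in [rho] and [n], of the integral of
  [|t ^ (x + n - 1) (1 - t) ^ (y - 1) f (rho / (t (1 - t)))|]: near the endpoints
  the substitution [v = t (1 - t) / rho] compares it with its value at
  [rho = 1 / 2], and elsewhere [f] is bounded.

  [B (omega, w) <> 0], for complex arguments, is proved without the Gamma
  function: otherwise the recursions of [B] give [B (omega + n, w + n) = 0] for
  all [n], while the weight [(t (1 - t)) ^ n] concentrates at [1 / 2], where the
  integrand does not vanish. *)

Require Import Defs.
From mathcomp Require Import all_boot all_order all_algebra.
From mathcomp Require Import complex.
From mathcomp Require Import all_classical all_reals all_analysis.
From mathcomp Require Import measurable_realfun ring lra.
Import Order.TTheory GRing.Theory Num.Theory.
Import numFieldNormedType.Exports.
Import ComplexField.Normc.
Local Open Scope classical_set_scope.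
Local Open Scope ring_scope.
Local Open Scope complex_scope.

Set Implicit Arguments.
Unset Strict Implicit.
Unset Printing Implicit Defensive.

(** * Complex sequences and series *)

(** The order of the exchanges is forced. Termwise integration over [t] is out of reach: the term of
    index [m] carries [(t (1 - t)) ^ (- m)], which for large [m] is not integrable against the beta
    weight, and the hypothesis only gives integrability of the whole function
    [f (rho / (t (1 - t)))], where cancellation may be essential. So the power series is expanded
    only under the integral over [rho], with [t] fixed, and the integral over [t] is moved by Fubini
    with [f] kept whole. Fubini and the sum over [n] both need a majorant in [rho], while the
    hypothesis speaks of each [rho] separately and [|f|] has no monotonicity that would compare two
    of them. The comparison works because [f] sees [rho] and [t] only through [t (1 - t) / rho]:
    after substitution, different [rho] give integrals of one function over different ranges.
    [B (omega, w) <> 0] is what yields statements about the extended function itself: its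
    integrability over [t] and the convergence of its series come out for its multiple by
    [B (omega, w)], and are then divided. *)

Section complex_sequences.
Variable R : realType.
Implicit Types (x y z l : R[i]) (u v : nat -> R[i]).

Lemma Re_nat n : complex.Re (n%:R : R[i]) = n%:R.
Proof. by rewrite -(rmorph_nat (real_complex R)). Qed.

Lemma cReD x y : complex.Re (x + y) = complex.Re x + complex.Re y.
Proof. by case: x y => ? ? [? ?]. Qed.

Lemma cImD x y : complex.Im (x + y) = complex.Im x + complex.Im y.
Proof. by case: x y => ? ? [? ?]. Qed.

Lemma cReN x : complex.Re (- x) = - complex.Re x.
Proof. by case: x. Qed.

Lemma cImN x : complex.Im (- x) = - complex.Im x.
Proof. by case: x. Qed.

Lemma cReM x y : complex.Re (x * y) =
  complex.Re x * complex.Re y - complex.Im x * complex.Im y.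
Proof. by case: x y => ? ? [? ?]. Qed.

Lemma cImM x y : complex.Im (x * y) =
  complex.Re x * complex.Im y + complex.Im x * complex.Re y.
Proof. by case: x y => ? ? [? ?]. Qed.

Lemma Re_sum (I : Type) (r : seq I) (P : pred I) (F : I -> R[i]) :
  complex.Re (\sum_(k <- r | P k) F k) = \sum_(k <- r | P k) complex.Re (F k).
Proof. by apply: (big_morph _ cReD). Qed.

Lemma Im_sum (I : Type) (r : seq I) (P : pred I) (F : I -> R[i]) :
  complex.Im (\sum_(k <- r | P k) F k) = \sum_(k <- r | P k) complex.Im (F k).
Proof. by apply: (big_morph _ cImD). Qed.

Lemma normc_norm z : `|z| = (normc z)%:C.
Proof. by []. Qed.

Lemma normc_ge0 z : 0 <= normc z.
Proof. by case: z => a b /=; rewrite sqrtr_ge0. Qed.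

Lemma normc_eq0 z : (normc z == 0) = (z == 0).
Proof.
apply/eqP/eqP => [/eq0_normc //|->]; exact: normc0.
Qed.

Lemma normc_gt0 z : (0 < normc z) = (z != 0).
Proof. by rewrite lt_neqAle normc_ge0 andbT eq_sym normc_eq0. Qed.

Lemma normcX z n : normc (z ^+ n) = normc z ^+ n.
Proof. by elim: n => [|n IH]; rewrite ?normc1// !exprS normcM IH. Qed.

Lemma normcR (r : R) : normc r%:C = `|r|.
Proof. by rewrite /normc/= expr0n/= addr0 sqrtr_sqr. Qed.

Lemma normc_natr n : normc (n%:R : R[i]) = n%:R.
Proof. by rewrite -(rmorph_nat (real_complex R)) normcR ger0_norm. Qed.

Lemma normc_distC x y : normc (x - y) = normc (y - x).
Proof. by rewrite -normcN opprB. Qed.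

Lemma ler_normc_sum (I : Type) (r : seq I) (P : pred I) (F : I -> R[i]) :
  normc (\sum_(k <- r | P k) F k) <= \sum_(k <- r | P k) normc (F k).
Proof.
elim/big_ind2 : _ => //; first by rewrite normc0.
move=> a b c d ha hb; apply: le_trans (le_normcD _ _) _; exact: lerD.
Qed.

Lemma normr_Re_le z : `|complex.Re z| <= normc z.
Proof.
case: z => a b /=; rewrite -sqrtr_sqr ler_wsqrtr// lerDl; exact: sqr_ge0.
Qed.

Lemma normr_Im_le z : `|complex.Im z| <= normc z.
Proof.
case: z => a b /=; rewrite -sqrtr_sqr ler_wsqrtr// lerDr; exact: sqr_ge0.
Qed.

Lemma normc_le_ReIm z : normc z <= `|complex.Re z| + `|complex.Im z|.
Proof.
case: z => a b /=; rewrite -(ger0_norm (addr_ge0 (normr_ge0 a) (normr_ge0 b))).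
rewrite -sqrtr_sqr ler_wsqrtr// sqrrD !real_normK ?num_real//.
by rewrite -addrA lerD2l lerDr mulrn_wge0// mulr_ge0.
Qed.

Lemma cvgcP u l : (u : nat -> R[i]^o) @ \oo --> (l : R[i]^o) <->
  (@complex.Re R \o u) @ \oo --> complex.Re l /\
  (@complex.Im R \o u) @ \oo --> complex.Im l.
Proof.
split => [/cvgrPdist_lt h|[/cvgrPdist_lt hr /cvgrPdist_lt hi]].
  split; apply/cvgrPdist_lt => e e0.
    have := h e%:C; rewrite ltcR => /(_ e0); apply: filterS => n.
    rewrite normc_norm ltcR; apply: le_lt_trans.
    by rewrite /= -cReN -cReD; exact: normr_Re_le.
  have := h e%:C; rewrite ltcR => /(_ e0); apply: filterS => n.
  rewrite normc_norm ltcR; apply: le_lt_trans.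
  by rewrite /= -cImN -cImD; exact: normr_Im_le.
apply/cvgrPdist_lt => -[e e'] e0.
(* Positivity in [R[i]] forces the imaginary part of the radius to be 0, so only real radii have to
   be tested. *)
move: (e0); rewrite ltcE/= => /andP[/eqP -> {}e0].
have e2 : 0 < e / 2 by rewrite divr_gt0.
have := hr _ e2; have := hi _ e2.
apply: filterS2 => n h1 h2.
rewrite normc_norm ltcR; apply: le_lt_trans (normc_le_ReIm _) _.
by rewrite cReD cImD cReN cImN (splitr e) ltrD.
Qed.

Lemma cvgc_unique u l : (u : nat -> R[i]^o) @ \oo --> (l : R[i]^o) ->
  limn (u : nat -> R[i]^o) = l.
Proof. by move=> h; apply: cvg_lim => //; exact: norm_hausdorff. Qed.

Lemma cvgc_cst l : (fun=> l : R[i]^o) @ \oo --> (l : R[i]^o).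
Proof. exact: cvg_cst. Qed.

Lemma cvgcD u v a b : (u : nat -> R[i]^o) @ \oo --> (a : R[i]^o) ->
  (v : nat -> R[i]^o) @ \oo --> (b : R[i]^o) ->
  (fun n => u n + v n : R[i]^o) @ \oo --> (a + b : R[i]^o).
Proof.
move=> /cvgcP[u1 u2] /cvgcP[v1 v2]; apply/cvgcP; rewrite cReD cImD; split.
- by rewrite /comp; under eq_fun do rewrite cReD; exact: cvgD.
- by rewrite /comp; under eq_fun do rewrite cImD; exact: cvgD.
Qed.

Lemma cvgcM u v a b : (u : nat -> R[i]^o) @ \oo --> (a : R[i]^o) ->
  (v : nat -> R[i]^o) @ \oo --> (b : R[i]^o) ->
  (fun n => u n * v n : R[i]^o) @ \oo --> (a * b : R[i]^o).
Proof.
move=> /cvgcP[u1 u2] /cvgcP[v1 v2]; apply/cvgcP; rewrite cReM cImM; split.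
- by rewrite /comp; under eq_fun do rewrite cReM; apply: cvgB; exact: cvgM.
- by rewrite /comp; under eq_fun do rewrite cImM; apply: cvgD; exact: cvgM.
Qed.

Definition csum_to u l := series (u : nat -> R[i]^o) @ \oo --> (l : R[i]^o).

Lemma Re_series u : @complex.Re R \o series (u : nat -> R[i]^o) = series (@complex.Re R \o u).
Proof. by apply/funext => n /=; rewrite /series/= Re_sum. Qed.

Lemma Im_series u : @complex.Im R \o series (u : nat -> R[i]^o) = series (@complex.Im R \o u).
Proof. by apply/funext => n /=; rewrite /series/= Im_sum. Qed.

Lemma csum_toP u l : csum_to u l <->
  series (@complex.Re R \o u) @ \oo --> complex.Re l /\
  series (@complex.Im R \o u) @ \oo --> complex.Im l.
Proof. by rewrite /csum_to -Re_series -Im_series; exact: cvgcP. Qed.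

Lemma csum_to_csum u l : csum_to u l -> csum u = l.
Proof. exact: cvgc_unique. Qed.

Lemma csum_to_summable u l : csum_to u l -> csummable u.
Proof. by move=> h; apply/cvg_ex; exists l. Qed.

Lemma csummable_to u : csummable u -> csum_to u (csum u).
Proof. by []. Qed.

Lemma csummable_norm u : cvgn (series (@normc R \o u)) -> csummable u.
Proof.
move=> h.
have hr : cvgn (series (@complex.Re R \o u)).
  apply: normed_cvg; apply: (@series_le_cvg _ _ (@normc R \o u)) => //= n; rewrite ?normr_ge0 ?normc_ge0 ?normr_Re_le ?normr_Im_le //.
have hi : cvgn (series (@complex.Im R \o u)).
  apply: normed_cvg; apply: (@series_le_cvg _ _ (@normc R \o u)) => //= n; rewrite ?normr_ge0 ?normc_ge0 ?normr_Re_le ?normr_Im_le //.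
move/cvg_ex: hr => [lr hr]; move/cvg_ex: hi => [li hi].
by apply: (@csum_to_summable _ (lr +i* li)); apply/csum_toP.
Qed.

Lemma csum_toZ c u l : csum_to u l -> csum_to (fun n => c * u n) (c * l).
Proof.
move=> h; rewrite /csum_to.
rewrite (_ : series _ = (fun n => (c : R[i]^o) * series (u : nat -> R[i]^o) n)).
  by apply: cvgM => //; exact: cvg_cst.
by apply/funext => n; rewrite /series/= mulr_sumr.
Qed.

Lemma csumZ c u : csummable u -> csum (fun n => c * u n) = c * csum u.
Proof. by move=> /csummable_to h; exact: csum_to_csum (csum_toZ h). Qed.

Lemma csummable_bounded u : csummable u -> exists M, forall n, normc (u n) <= M.
Proof.
move=> hu.
have := csummable_to hu => /csum_toP[hr hi].
have cr : cvgn (series (@complex.Re R \o u)) by apply/cvg_ex; eexists; exact: hr.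
have ci : cvgn (series (@complex.Im R \o u)) by apply/cvg_ex; eexists; exact: hi.
have [M1 [_ h1]] := cvg_series_bounded cr.
have [M2 [_ h2]] := cvg_series_bounded ci.
exists ((M1 + 1) + (M2 + 1)) => n.
apply: le_trans (normc_le_ReIm _) _; apply: lerD.
  by apply: (h1 (M1 + 1)) => //; rewrite ltrDl.
by apply: (h2 (M2 + 1)) => //; rewrite ltrDl.
Qed.

End complex_sequences.

(** * Complex integrals over the unit interval *)

(** Inversion is discontinuous at 0, where its value is 0 by convention; that point is split off and
    the open complement handled by continuity. This makes [r / (t (1 - t))] measurable everywhere,
    including where the denominator vanishes. *)
Lemma measurable_invr (R : realType) : measurable_fun [set: R] (@GRing.inv R).
Proof.
have -> : [set: R] = [set 0] `|` ~` [set 0] by rewrite setUv.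
apply/measurable_funU => //; first exact: measurableC.
split; first exact: measurable_fun_set1.
apply: open_continuous_measurable_fun.
  apply: closed_openC; apply: accessible_closed_set1.
  by apply: hausdorff_accessible; exact: norm_hausdorff.
by move=> x; rewrite inE/= => /eqP x0; exact: inv_continuous.
Qed.

Section complex_measurable.
Context d (T : measurableType d) (R : realType).
Implicit Types (D : set T) (f g : T -> R[i]) (r : T -> R).

Definition cmeas D f := measurable_fun D (fun x => complex.Re (f x)) /\
  measurable_fun D (fun x => complex.Im (f x)).

Lemma cmeas_cst D c : cmeas D (fun=> c).
Proof. by split; exact: measurable_cst. Qed.

Lemma cmeasS D f : cmeas setT f -> cmeas D f.
Proof. by move=> [h1 h2]; split; exact: measurable_funTS. Qed.

Lemma cmeasD D f g : cmeas D f -> cmeas D g -> cmeas D (fun x => f x + g x).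
Proof.
move=> [h1 h2] [h3 h4]; split.
- by under eq_fun do rewrite cReD; exact: measurable_funD.
- by under eq_fun do rewrite cImD; exact: measurable_funD.
Qed.

Lemma cmeasM D f g : cmeas D f -> cmeas D g -> cmeas D (fun x => f x * g x).
Proof.
move=> [h1 h2] [h3 h4]; split.
- under eq_fun do rewrite cReM.
  by apply: measurable_funB; exact: measurable_funM.
- under eq_fun do rewrite cImM.
  by apply: measurable_funD; exact: measurable_funM.
Qed.

Lemma cmeas_real D r : measurable_fun D r -> cmeas D (fun x => (r x)%:C).
Proof. by move=> h; split => //=; exact: measurable_cst. Qed.

Lemma cmeas_normc D f : cmeas D f -> measurable_fun D (fun x => normc (f x)).
Proof.
move=> [h1 h2].
rewrite (_ : (fun x => _) = (@powR R ^~ 2^-1) \o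
    (fun x => complex.Re (f x) ^+ 2 + complex.Im (f x) ^+ 2)).
  have h : measurable_fun D (fun x => complex.Re (f x) ^+ 2 + complex.Im (f x) ^+ 2).
    by apply: measurable_funD; exact: measurable_funX.
  by have := measurableT_comp (measurable_powR (2^-1 : R)) h; exact.
by apply/funext => x; rewrite /= powR12_sqrt ?addr_ge0 ?sqr_ge0//; case: (f x).
Qed.

Lemma cmeas_sum (I : Type) (s : seq I) D (F : I -> T -> R[i]) :
  (forall i, cmeas D (F i)) -> cmeas D (fun x => \sum_(i <- s) F i x).
Proof.
move=> h; elim: s => [|a s IH].
  by under eq_fun do rewrite big_nil; exact: cmeas_cst.
by under eq_fun do rewrite big_cons; exact: cmeasD.
Qed.

Lemma cmeas_cpow r z : measurable_fun setT r -> cmeas setT (fun x => cpow (r x) z).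
Proof.
move=> mr; rewrite /cpow /cexp.
have ml : measurable_fun setT (fun x => ln (r x)).
  exact: measurableT_comp (@measurable_ln R) mr.
have ma : cmeas setT (fun x => z * (ln (r x))%:C).
  by apply: cmeasM; [exact: cmeas_cst|exact: cmeas_real].
apply: cmeasM.
  apply: cmeas_real; apply: measurableT_comp => //; exact: ma.1.
split => /=; (apply: measurableT_comp; last exact: ma.2);
  apply: continuous_measurable_fun; [exact: continuous_cos|exact: continuous_sin].
Qed.

End complex_measurable.

Lemma cmeas_comp d d' (T : measurableType d) (T' : measurableType d') (R : realType)
    (f : T' -> R[i]) (g : T -> T') :
  cmeas setT f -> measurable_fun setT g -> cmeas setT (fun x => f (g x)).
Proof. by move=> [h1 h2] hg; split; [exact: measurableT_comp h1 hg|exact: measurableT_comp h2 hg]. Qed.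

Section complex_integral.
Context (R : realType).
Local Notation mu := (@lebesgue_measure R).
Local Notation D := (`]0, 1[%classic : set R).
Implicit Types (f g : R -> R[i]).

Let mD : measurable (D : set (measurableTypeR R)).
Proof. exact: measurable_itv. Qed.

(** The coordinates are bounded by the modulus, and the modulus by the sum of their absolute values.
    Domination arguments can therefore be run on the modulus alone. *)
Lemma cintegrable01P f : cintegrable01 f <->
  cmeas D f /\ mu.-integrable D (fun t => (normc (f t))%:E).
Proof.
split=> [[h1 h2]|[mf nf]].
  have mf : cmeas D f.
    split; apply/measurable_EFinP.
    - exact: measurable_int h1.
    - exact: measurable_int h2.
  split => //.
  apply: (@le_integrable _ _ _ mu D mD _ (fun t => (`|complex.Re (f t)|)%:E + (`|complex.Im (f t)|)%:E)%E).
  - exact/measurable_EFinP/cmeas_normc.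
  - move=> t Dt; rewrite -EFinD lee_fin ger0_norm ?normc_ge0//.
    by apply: le_trans (normc_le_ReIm _) _; exact: ler_norm.
  - by apply: integrableD => //; exact: integrable_norm.
split.
- apply: le_integrable nf => //; first by apply/measurable_EFinP; exact: mf.1.
  by move=> t Dt; rewrite lee_fin [leRHS]ger0_norm ?normc_ge0 ?normr_Re_le.
- apply: le_integrable nf => //; first by apply/measurable_EFinP; exact: mf.2.
  by move=> t Dt; rewrite lee_fin [leRHS]ger0_norm ?normc_ge0 ?normr_Im_le.
Qed.

Lemma cintegrable01_le f (g : R -> R) : cmeas D f ->
  mu.-integrable D (fun t => (g t)%:E) -> (forall t, 0 < t < 1 -> normc (f t) <= g t) ->
  cintegrable01 f.
Proof.
move=> mf ig h; apply/cintegrable01P; split => //.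
apply: le_integrable ig => //.
  exact/measurable_EFinP/cmeas_normc.
move=> t; rewrite /= in_itv/= => Dt; rewrite lee_fin ger0_norm ?normc_ge0//.
by apply: le_trans (h t Dt) _; exact: ler_norm.
Qed.

Lemma eq_cint01 f g : (forall t, 0 < t < 1 -> f t = g t) -> cint01 f = cint01 g.
Proof.
by move=> h; rewrite /cint01; congr Complex; apply: eq_Rintegral => t;
  rewrite inE/= in_itv/= => /h ->.
Qed.

Lemma eq_cintegrable01 f g : (forall t, 0 < t < 1 -> f t = g t) ->
  cintegrable01 f -> cintegrable01 g.
Proof.
move=> h [h1 h2]; split.
- by apply: eq_integrable h1 => // t; rewrite inE/= in_itv/= => /h ->.
- by apply: eq_integrable h2 => // t; rewrite inE/= in_itv/= => /h ->.
Qed.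

Lemma cintegrable01D f g : cintegrable01 f -> cintegrable01 g ->
  cintegrable01 (fun t => f t + g t).
Proof.
move=> [f1 f2] [g1 g2]; split.
- apply: (eq_integrable mD _ _ _ (integrableD mD f1 g1)) => // t _.
  by rewrite /= -EFinD -cReD.
- apply: (eq_integrable mD _ _ _ (integrableD mD f2 g2)) => // t _.
  by rewrite /= -EFinD -cImD.
Qed.

Lemma cint01D f g : cintegrable01 f -> cintegrable01 g ->
  cint01 (fun t => f t + g t) = cint01 f + cint01 g.
Proof.
move=> [f1 f2] [g1 g2]; rewrite /cint01 -[RHS]/((_ + _) +i* (_ + _)).
by congr Complex; rewrite -RintegralD//; apply: eq_Rintegral => t _;
  [exact: cReD|exact: cImD].
Qed.

Lemma cintegrable01Z c f : cintegrable01 f -> cintegrable01 (fun t => c * f t).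
Proof.
move=> [f1 f2]; split.
- apply: (eq_integrable mD _ _ _ (integrableB mD (integrableZl mD (complex.Re c) f1)
    (integrableZl mD (complex.Im c) f2))) => // t _.
  by rewrite /= -!EFinM -EFinB -cReM.
- apply: (eq_integrable mD _ _ _ (integrableD mD (integrableZl mD (complex.Re c) f2)
    (integrableZl mD (complex.Im c) f1))) => // t _.
  by rewrite /= -!EFinM -EFinD -cImM.
Qed.

Lemma cint01Z c f : cintegrable01 f -> cint01 (fun t => c * f t) = c * cint01 f.
Proof.
move=> [f1 f2]; rewrite /cint01.
have z a (h : R -> R) : mu.-integrable D (EFin \o h) -> mu.-integrable D (EFin \o (fun t => a * h t)).
  by move=> ih; exact: (integrableZl mD a ih).
case: c => a b; rewrite -[RHS]/((_ - _) +i* (_ + _)); congr Complex.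
- rewrite -!RintegralZl// -RintegralB//; try exact: z.
  by apply: eq_Rintegral => t _; rewrite cReM.
- rewrite -!RintegralZl// -RintegralD//; try exact: z.
  by apply: eq_Rintegral => t _; rewrite cImM.
Qed.

Lemma cint01_sum (F : nat -> R -> R[i]) n :
  (forall k, cintegrable01 (F k)) ->
  cintegrable01 (fun t => \sum_(0 <= k < n) F k t) /\
  cint01 (fun t => \sum_(0 <= k < n) F k t) = \sum_(0 <= k < n) cint01 (F k).
Proof.
move=> h; elim: n => [|n [IH1 IH2]].
  have e : (fun t => \sum_(0 <= k < 0) F k t) = (fun=> 0).
    by apply/funext => t; rewrite big_geq.
  rewrite e; split.
    by split; exact: integrable0.
  by rewrite big_geq// /cint01/= !Rintegral_cst//= !mul0r.
have e : (fun t => \sum_(0 <= k < n.+1) F k t) = (fun t => \sum_(0 <= k < n) F k t + F n t).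
  by apply/funext => t; rewrite big_nat_recr.
rewrite e; split; first exact: cintegrable01D.
by rewrite cint01D// IH2 big_nat_recr.
Qed.

End complex_integral.

(** * Dominated convergence, and the exchange of a complex series with an integral *)

Lemma Rintegral_dominated_cvg (R : realType)
    (D : set R) (u : nat -> R -> R) (f g : R -> R) :
  measurable (D : set (measurableTypeR R)) ->
  (forall n, measurable_fun D (u n)) ->
  (forall t, D t -> (u ^~ t) @ \oo --> f t) ->
  (@lebesgue_measure R).-integrable D (EFin \o g) ->
  (forall n t, D t -> `|u n t| <= g t) ->
  (@lebesgue_measure R).-integrable D (EFin \o f) /\
  (fun n => Rintegral (@lebesgue_measure R) D (u n)) @ \oo -->
    Rintegral (@lebesgue_measure R) D f.
Proof.
move=> mD mu uf ig ug.
have mf : measurable_fun D f by apply: (measurable_fun_cvg mu uf).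
have [||||h1 _ h3] := @dominated_convergence _ _ _ (@lebesgue_measure R) _ mD
    (fun n => EFin \o u n) (EFin \o f) (EFin \o g) _ _ _ ig _.
- by move=> n; apply/measurable_EFinP; exact: mu.
- by apply/measurable_EFinP; exact: mf.
- by apply: aeW => t Dt; apply: cvg_EFin; [exact: nearW|exact: uf].
- by apply: aeW => t n Dt; rewrite lee_fin; exact: ug.
split=> //.
apply: fine_cvg; rewrite fineK; first exact: h3.
exact: integrable_fin_num h1.
Qed.

Section dominated_series.
Context (R : realType).
Local Notation mu := (@lebesgue_measure R).
Local Notation D := (`]0, 1[%classic : set R).

Let mD : measurable (D : set (measurableTypeR R)).
Proof. exact: measurable_itv. Qed.

(** A majorant with separated variables covers both exchanges to come: the power series under the
    beta transform and the outer series over [n]. The partial sums are then dominated by the sum of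
    [c] times [|g|]. *)
Lemma cint01_csum (u : nat -> R -> R[i]) (c : nat -> R) (g : R -> R) :
  (forall n, cmeas D (u n)) -> mu.-integrable D (EFin \o g) ->
  (forall n, 0 <= c n) -> cvgn (series c) ->
  (forall n (t : R), 0 < t < 1 -> normc (u n t) <= c n * g t) ->
  [/\ forall t, 0 < t < 1 -> csummable (u ^~ t),
    cintegrable01 (fun t => csum (u ^~ t)) &
    csum_to (fun n => cint01 (u n)) (cint01 (fun t => csum (u ^~ t)))].
Proof.
move=> mu_ ig c0 cc hu.
have hu' n (t : R) : 0 < t < 1 -> normc (u n t) <= c n * `|g t|.
  by move=> /(hu n) h; apply: le_trans h _; rewrite ler_wpM2l ?ler_norm.
have su (t : R) : 0 < t < 1 -> csummable (u ^~ t).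
  move=> t01; apply: csummable_norm.
  apply: (@series_le_cvg _ _ (fun n => `|g t| * c n)) => /=.
  - by move=> n; exact: normc_ge0.
  - by move=> n; rewrite mulr_ge0.
  - by move=> n; rewrite mulrC; exact: hu'.
  - exact: (is_cvg_seriesZ (k := `|g t| : R) cc).
have iu n : cintegrable01 (u n).
  apply: (@cintegrable01_le _ _ (fun t => c n * `|g t|)) => //; last exact: hu'.
  exact: (integrableZl mD (c n) (integrable_norm ig)).
pose S n t := \sum_(0 <= k < n) u k t.
have iS n : cintegrable01 (S n) /\ cint01 (S n) = _ := cint01_sum n iu.
have nS n (t : R) : 0 < t < 1 -> normc (S n t) <= limn (series c) * `|g t|.
  move=> t01; apply: le_trans (ler_normc_sum _ _ _) _.
  apply: (@le_trans _ _ (series c n * `|g t|)).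
    by rewrite /series/= mulr_suml; apply: ler_sum => k _; exact: hu'.
  rewrite ler_wpM2r//; apply: nondecreasing_cvgn_le => //.
  by apply: nondecreasing_series => k _.
have iG : mu.-integrable D (EFin \o (fun t => limn (series c) * `|g t|)).
  exact: (integrableZl mD (limn (series c)) (integrable_norm ig)).
have [iR cR] := @Rintegral_dominated_cvg R D (fun n t => complex.Re (S n t))
   (fun t => complex.Re (csum (u ^~ t))) (fun t => limn (series c) * `|g t|) mD
   (fun n => (cmeas_sum (index_iota 0 n) mu_).1)
   ltac:(move=> t; rewrite /= in_itv/= => /su/csummable_to/csum_toP[+ _];
         by rewrite -Re_series) iG
   ltac:(move=> n t; rewrite /= in_itv/= => t01;
         exact: le_trans (normr_Re_le _) (nS n t t01)).
have [iI cI] := @Rintegral_dominated_cvg R D (fun n t => complex.Im (S n t))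
   (fun t => complex.Im (csum (u ^~ t))) (fun t => limn (series c) * `|g t|) mD
   (fun n => (cmeas_sum (index_iota 0 n) mu_).2)
   ltac:(move=> t; rewrite /= in_itv/= => /su/csummable_to/csum_toP[_];
         by rewrite -Im_series) iG
   ltac:(move=> n t; rewrite /= in_itv/= => t01;
         exact: le_trans (normr_Im_le _) (nS n t t01)).
split => //.
rewrite /csum_to.
rewrite (_ : series _ = (fun n => cint01 (S n))); last first.
  by apply/funext => n; rewrite (iS n).2.
by apply/cvgcP; split.
Qed.

End dominated_series.

(** * Complex powers and Gauss' product for Gamma *)

Section cexp_cpow.
Variable R : realType.
Implicit Types (x y z : R[i]) (s t : R).

Lemma cexpD x y : cexp (x + y) = cexp x * cexp y.
Proof.
case: x y => a b [c d]; rewrite /cexp /= expRD cosD sinD rmorphM/=.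
by apply/eqP; rewrite eq_complex/=; apply/andP; split; apply/eqP; ring.
Qed.

Lemma Re_cexp x : complex.Re (cexp x) = expR (complex.Re x) * cos (complex.Im x).
Proof. by rewrite /cexp cReM/= mul0r subr0. Qed.

Lemma Im_cexp x : complex.Im (cexp x) = expR (complex.Re x) * sin (complex.Im x).
Proof. by rewrite /cexp cImM/= mul0r addr0. Qed.

Lemma normc_cexp x : normc (cexp x) = expR (complex.Re x).
Proof.
by rewrite /cexp normcM normcR /normc cos2Dsin2 sqrtr1 mulr1 ger0_norm//.
Qed.

Lemma cexp_neq0 x : cexp x != 0.
Proof. by rewrite -normc_gt0 normc_cexp expR_gt0. Qed.

Lemma cpowD t x y : cpow t (x + y) = cpow t x * cpow t y.
Proof. by rewrite /cpow mulrDl cexpD. Qed.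

Lemma cpow_neq0 t x : cpow t x != 0.
Proof. exact: cexp_neq0. Qed.

Lemma cpowM s t x : 0 < s -> 0 < t -> cpow (s * t) x = cpow s x * cpow t x.
Proof. by move=> s0 t0; rewrite /cpow lnM// rmorphD/= mulrDr cexpD. Qed.

Lemma cpow1 t : 0 < t -> cpow t (1 : R[i]) = t%:C.
Proof.
by move=> t0; rewrite /cpow mul1r /cexp/= cos0 sin0 lnK// complexr0 mulr1.
Qed.

Lemma cpowS t x : 0 < t -> cpow t (x + 1) = cpow t x * t%:C.
Proof. by move=> t0; rewrite cpowD cpow1. Qed.

Lemma cpowDn t x n : 0 < t -> cpow t (x + n%:R) = cpow t x * (t ^+ n)%:C.
Proof.
move=> t0; elim: n => [|n IH]; first by rewrite addr0 expr0 mulr1.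
by rewrite -natr1 addrA cpowS// IH exprSr rmorphM mulrA.
Qed.

Lemma normc_cpow t x : 0 < t -> normc (cpow t x) = t `^ complex.Re x.
Proof.
move=> t0; rewrite /cpow normc_cexp /powR gt_eqF//; congr expR.
by case: x => a b /=; rewrite mulr0 subr0.
Qed.

(** From [exp (- t) >= 1 - t] follows [exp t <= 1 / (1 - t)], hence a defect of at most
    [t ^ 2 / (1 - t)]; [t <= 1/2] bounds the last factor by 2. *)
Lemma expR_sub1Dx_le t : t <= 2^-1 -> 0 <= expR t - 1 - t <= t ^+ 2 *+ 2.
Proof.
move=> t2; have h1 := expR_ge1Dx t; apply/andP; split; first by lra.
have t1 : 0 < 1 - t by lra.
have h2 := expR_ge1Dx (- t).
have h3 : expR t <= (1 - t)^-1.
  rewrite -[expR t]invrK -expRN lef_pV2 ?posrE ?expR_gt0//; lra.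
have h4 : expR t * (1 - t) <= 1 by rewrite -ler_pdivlMr// div1r.
suff : (expR t - 1 - t) * (1 - t) <= (t ^+ 2 *+ 2) * (1 - t).
  by rewrite ler_pM2r.
have h5 : 0 <= t ^+ 2 * (1 - t *+ 2).
  by rewrite mulr_ge0 ?sqr_ge0// subr_ge0 -mulr_natr; lra.
have h6 : (expR t - 1 - t) * (1 - t) = expR t * (1 - t) - 1 + t ^+ 2 by ring.
have h7 : (t ^+ 2 *+ 2) * (1 - t) = t ^+ 2 + t ^+ 2 * (1 - t *+ 2) by ring.
rewrite h6 h7; move: h5 h4; set u := t ^+ 2 * _; set w := expR t * _; lra.
Qed.

(** The intermediate point is kept because [cos c] serves twice: [|cos c| <= 1] gives the linear
    bound on [sin], and [1 - cos c <= c ^ 2 / 2] with [|c| <= |t|] gives the bound on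
    [sin t - t]. *)
Lemma sin_MVT t : exists2 c, `|c| <= `|t| & sin t = cos c * t.
Proof.
have ge0 (u : R) : 0 <= u -> exists2 c, `|c| <= `|u| & sin u = cos c * u.
  move=> u0.
  have [|c] := @MVT_segment R sin cos 0 u u0 _ _.
    by apply: continuous_subspaceT => x; exact: continuous_sin.
  rewrite in_itv/= => /andP[c0 cu]; rewrite sin0 !subr0 => e.
  by exists c => //; rewrite !ger0_norm.
have [/ge0//|/ltW] := leP 0 t.
rewrite -oppr_ge0 => /ge0[c]; rewrite normrN sinN mulrN => h /oppr_inj e.
by exists c.
Qed.

Lemma normr_sin_le t : `|sin t| <= `|t|.
Proof.
have [c _ ->] := sin_MVT t.
by rewrite normrM ler_piMl// cos_max.
Qed.

(** Half-angle formula: [1 - cos t] is twice the square of [sin (t / 2)]. *)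
Lemma onemcos_le t : 0 <= 1 - cos t <= t ^+ 2 / 2.
Proof.
rewrite subr_ge0 cos_le1/=.
have -> : cos t = cos (t / 2) ^+ 2 *+ 2 - 1 by rewrite -cos_mulr2n; congr cos; rewrite -[RHS]mulr_natr divfK.
have := normr_sin_le (t / 2); rewrite -ler_sqr ?nnegrE// !real_normK ?num_real//.
rewrite sin2cos2 => h; rewrite -mulr_natr.
have e : (t / 2) ^+ 2 = t ^+ 2 / 4 by field.
rewrite e in h; move: h; set c := cos _ ^+ 2; set d := t ^+ 2; lra.
Qed.

Lemma sin_sub_le t : `|t| <= 1 -> `|sin t - t| <= t ^+ 2.
Proof.
move=> t1; have [c ct ->] := sin_MVT t.
have -> : cos c * t - t = - ((1 - cos c) * t) by ring.
have /andP[h1 h2] := onemcos_le c.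
rewrite normrN normrM (ger0_norm h1).
have h3 : c ^+ 2 <= t ^+ 2 by rewrite -(real_normK (num_real c)) -(real_normK (num_real t)) ler_sqr ?nnegrE.
have h5 : 0 <= t ^+ 2 by exact: sqr_ge0.
apply: (@le_trans _ _ (1 - cos c)); first by rewrite ler_piMr.
by apply: le_trans h2 _; lra.
Qed.

(** With [x = a + i b], the two coordinates have defects at most [2 a ^ 2 + b ^ 2] and
    [a ^ 2 + 3 b ^ 2], whose sum is below [4 (a ^ 2 + b ^ 2)]. The second order is what makes the
    defects of Gauss' product summable. *)
Lemma cexp_sub1Dx_le x : normc x <= 2^-1 ->
  normc (cexp x - 1 - x) <= 4 * normc x ^+ 2.
Proof.
move=> hx.
have ha := le_trans (normr_Re_le x) hx; have hb := le_trans (normr_Im_le x) hx.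
have -> : normc x ^+ 2 = complex.Re x ^+ 2 + complex.Im x ^+ 2.
  by case: (x) => a b /=; rewrite sqr_sqrtr ?addr_ge0 ?sqr_ge0.
apply: le_trans (normc_le_ReIm _) _.
rewrite !cReD !cReN !cImD !cImN Re_cexp Im_cexp /= oppr0 addr0.
move: ha hb; set a := complex.Re x; set b := complex.Im x => ha hb.
have /andP[a1 a2] : 0 <= expR a - 1 - a <= a ^+ 2 *+ 2.
  by apply: expR_sub1Dx_le; apply: le_trans ha; exact: ler_norm.
have /andP[b1 b2] := onemcos_le b.
have hb1 : `|b| <= 1 by apply: le_trans hb _; lra.
have b3 := sin_sub_le hb1.
have e0 := expR_gt0 a.
have a3 : a ^+ 2 *+ 2 <= `|a|.
  rewrite -(real_normK (num_real a)) -mulr_natr expr2 -mulrA ler_piMr//.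
  by rewrite -ler_pdivlMr// div1r.
have e2 : expR a <= 2.
  by have := ler_norm a; lra.
have h1 : `|expR a * cos b - 1 - a| <= b ^+ 2 + a ^+ 2 *+ 2.
  have -> : expR a * cos b - 1 - a = (expR a - 1 - a) - expR a * (1 - cos b) by ring.
  apply: le_trans (ler_normB _ _) _.
  rewrite addrC lerD//; last by rewrite ger0_norm.
  rewrite ger0_norm ?mulr_ge0 ?(ltW e0)//.
  apply: (@le_trans _ _ (2 * (b ^+ 2 / 2))); first by rewrite ler_pM ?(ltW e0).
  by rewrite mulrC divfK.
have h2 : `|expR a * sin b - b| <= b ^+ 2 *+ 2 + (a ^+ 2 + b ^+ 2).
  have -> : expR a * sin b - b = expR a * (sin b - b) + (expR a - 1) * b by ring.
  apply: le_trans (ler_normD _ _) _; apply: lerD.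
    by rewrite normrM (ger0_norm (ltW e0)) -mulr_natl ler_pM// ltW.
  rewrite normrM.
  have h3 : `|expR a - 1| <= `|a| *+ 2.
    have -> : expR a - 1 = (expR a - 1 - a) + a by ring.
    apply: le_trans (ler_normD _ _) _; rewrite mulr2n lerD2r ger0_norm//.
    exact: le_trans a2 a3.
  rewrite -(real_normK (num_real a)) -(real_normK (num_real b)).
  apply: (@le_trans _ _ ((`|a| *+ 2) * `|b|)); first by rewrite ler_wpM2r.
  have := sqr_ge0 (`|a| - `|b|); rewrite sqrrB mulrnAl; move: (_ * _) => c.
  by rewrite addrAC subr_ge0.
apply: (le_trans (lerD h1 h2)).
have := sqr_ge0 a; have := sqr_ge0 b.
rewrite !mulr2n; lra.
Qed.

End cexp_cpow.

(** * Convergence of Gauss' product to a nonzero limit, and the recursion of the Pochhammer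
    symbols *)

Section cgamma.
Variable R : realType.
Implicit Types z : R[i].

(** A substitute for the theory of infinite products: relative increments of total at most 1/4 keep
    every [v n] within [|v 0| / 2] of [v 0]. The increments are then absolutely summable, and the
    limit stays away from 0. *)
Lemma cvgc_quasi_constant (v : nat -> R[i]) (r : nat -> R) :
  v 0%N != 0 -> (forall n, 0 <= r n) -> (forall n, series r n <= 4^-1) ->
  (forall n, normc (v n.+1 - v n) <= r n * normc (v n)) ->
  exists2 l : R[i], l != 0 & (v : nat -> R[i]^o) @ \oo --> (l : R[i]^o).
Proof.
move=> v0 r0 sr hv.
have v0gt : 0 < normc (v 0%N) by rewrite normc_gt0.
have s2 n : series r n * normc (v 0%N) *+ 2 <= normc (v 0%N) / 2.
  have := ler_wpM2r (ltW v0gt) (sr n); rewrite mulr2n.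
  by set a := series r n * _; lra.
have s4 n : series r n * normc (v 0%N) *+ 2 <= normc (v 0%N).
  by have := s2 n; set a := _ *+ 2; lra.
(* The factor 2 closes the induction: the bound at [n] gives [|v n| <= 2 |v 0|], so the next
   increment is at most [2 r n |v 0|]. *)
have key n : normc (v n - v 0%N) <= series r n * normc (v 0%N) *+ 2.
  elim: n => [|n IH]; first by rewrite subrr normc0 seriesEnat/= big_geq// mul0r mul0rn.
  have -> : v n.+1 - v 0%N = (v n.+1 - v n) + (v n - v 0%N) by rewrite addrA subrK.
  apply: le_trans (le_normcD _ _) _.
  have h1 : normc (v n) <= normc (v 0%N) *+ 2.
    have -> : v n = (v n - v 0%N) + v 0%N by rewrite subrK.
    apply: le_trans (le_normcD _ _) _.
    rewrite [leRHS]mulr2n lerD2r; exact: le_trans IH (s4 n).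
  rewrite seriesSr mulrDl mulrnDl addrC lerD//.
  by apply: le_trans (hv n) _; rewrite -mulrnAr ler_wpM2l.
have bnd n : normc (v n) <= normc (v 0%N) *+ 2.
  have -> : v n = (v n - v 0%N) + v 0%N by rewrite subrK.
  apply: le_trans (le_normcD _ _) _.
  rewrite [leRHS]mulr2n lerD2r; exact: le_trans (key n) (s4 n).
have cr : cvgn (series r).
  apply: nondecreasing_is_cvgn.
    by apply: nondecreasing_series => n _.
  by exists 4^-1 => _ [n _ <-].
have /csummable_to sv : csummable (fun n => v n.+1 - v n).
  apply: csummable_norm.
  apply: (@series_le_cvg _ _ (fun n => (normc (v 0%N) *+ 2) * r n)) => /=.
  - by move=> n; exact: normc_ge0.
  - by move=> n; rewrite mulr_ge0// mulrn_wge0// normc_ge0.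
  - move=> n; apply: le_trans (hv n) _; rewrite mulrC ler_wpM2r//.
  - exact: (is_cvg_seriesZ (k := (normc (v 0%N) *+ 2) : R) cr).
set l0 := csum _ in sv.
have cv : (v : nat -> R[i]^o) @ \oo --> (l0 + v 0%N : R[i]^o).
  have := cvgcD sv (@cvgc_cst R (v 0%N)).
  rewrite (_ : (fun n => _ + _) = v)//.
  by apply/funext => n; rewrite /series/= telescope_sumr// subrK.
exists (l0 + v 0%N) => //.
(* A zero limit would give [|v n| < |v 0| / 4] for some [n], whereas [key] gives
   [|v n| >= |v 0| / 2]. *)
apply/eqP => l1; move: cv; rewrite l1 => /cvgrPdist_lt/(_ (normc (v 0%N) / 4)%:C).
rewrite ltcR divr_gt0// => /(_ isT)[n _ /(_ n (leqnn n))].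
rewrite /= sub0r normrN normc_norm ltcR => h.
have h2 : normc (v 0%N) <= normc (v n) + normc (v n - v 0%N).
  rewrite (normc_distC (v n)) -{1}(subrK (v n) (v 0%N)) addrC; exact: le_normcD.
have := le_trans (key n) (s2 n); lra.
Qed.

Definition gauss z (n : nat) : R[i] :=
  n`!%:R * cpow n%:R z / \prod_(k < n.+1) (z + (k : nat)%:R).

Lemma cgammaE z (l : R[i]) : (gauss z : nat -> R[i]^o) @ \oo --> (l : R[i]^o) ->
  cgamma z = l.
Proof. exact: cvgc_unique. Qed.

Lemma addn_neq0 z n : 0 < complex.Re z -> z + n%:R != 0.
Proof.
move=> z0; apply/eqP => e.
have := congr1 (@complex.Re R) e; rewrite cReD Re_nat /= => h.
have : 0 < complex.Re z + n%:R :> R by rewrite ltr_wpDr.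
by rewrite h ltxx.
Qed.

Lemma normc_addn_ge z n : 0 < complex.Re z -> n%:R <= normc (z + n%:R).
Proof.
move=> z0; apply: le_trans (normr_Re_le _); rewrite cReD Re_nat.
by apply: le_trans (ler_norm _); rewrite lerDr ltW.
Qed.

(** The recursion starts at index 1, since from index 0 the ratio of consecutive bases would have
    denominator 0. *)
Lemma gaussS z n : 0 < complex.Re z ->
  gauss z n.+2 = gauss z n.+1 *
   ((n.+2)%:R * cpow (n.+2%:R / n.+1%:R) z / (z + n.+2%:R)).
Proof.
move=> z0; rewrite /gauss [in LHS]big_ord_recr/= factS natrM.
have -> : cpow n.+2%:R z = cpow (n.+2%:R / n.+1%:R) z * cpow n.+1%:R z.
  by rewrite -cpowM ?divr_gt0 ?ltr0n// divfK.
rewrite invfM; ring.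
Qed.

Lemma gauss_neq0 z n : 0 < complex.Re z -> gauss z n != 0.
Proof.
move=> z0; rewrite /gauss mulf_neq0// ?invr_neq0//; last first.
  by apply/prodf_neq0 => i _; exact: addn_neq0.
by rewrite mulf_neq0 ?cpow_neq0// -normc_eq0 normc_natr pnatr_eq0 -lt0n.
Qed.

(** Both sides are instances of [ln (1 + x) <= x], the lower one applied to the inverse ratio, which
    is [1 - 1 / (n + 2)]. *)
Lemma ln_succ_ratio (n : nat) :
  n.+2%:R^-1 <= ln (n.+2%:R / n.+1%:R : R) <= n.+1%:R^-1.
Proof.
have p1 : 0 < n.+1%:R :> R by rewrite ltr0n.
have p2 : 0 < n.+2%:R :> R by rewrite ltr0n.
apply/andP; split.
  rewrite -[X in ln X]invrK lnV ?posrE ?invr_gt0 ?divr_gt0// invf_div lerNr.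
  have -> : n.+1%:R / n.+2%:R = 1 + (- n.+2%:R^-1) :> R.
    apply: (mulIf (lt0r_neq0 p2)); rewrite mulrDl mulNr mulVf ?divfK ?gt_eqF//.
    by rewrite mul1r -[n.+2%:R]natr1 addrK.
  apply: le_ln1Dx; rewrite ltrN2 invf_lt1// ltr1n//.
have -> : n.+2%:R / n.+1%:R = 1 + n.+1%:R^-1 :> R.
  by rewrite -[n.+2%:R]natr1 mulrDl divff ?gt_eqF// mul1r.
by apply: le_ln1Dx; apply: (@lt_le_trans _ _ 0); rewrite ?invr_ge0 ?ltrN10 ?ltW.
Qed.

(* Bounding the defect by a telescoping sequence rather than by [n ^ -2] makes
   its partial sums explicit. *)
Lemma gauss_ratio_near1 z n : 0 < complex.Re z -> normc z *+ 2 <= n.+1%:R ->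
  normc ((n.+2)%:R * cpow (n.+2%:R / n.+1%:R) z / (z + n.+2%:R) - 1) <=
  (8 * normc z ^+ 2 + normc z) * (n.+1%:R^-1 - n.+2%:R^-1).
Proof.
move=> z0 zn.
have p1 : 0 < n.+1%:R :> R by rewrite ltr0n.
have p2 : 0 < n.+2%:R :> R by rewrite ltr0n.
set h := ln (n.+2%:R / n.+1%:R : R).
have /andP[h1 h2] := ln_succ_ratio n; rewrite -/h in h1 h2.
have h0 : 0 <= h by apply: le_trans h1; rewrite invr_ge0 ltW.
have nh : normc (z * h%:C) = normc z * h by rewrite normcM normcR ger0_norm.
have nz := normc_ge0 z.
have hz : normc z * h <= normc z * n.+1%:R^-1 by rewrite ler_wpM2l.
have hz2 : normc (z * h%:C) <= 2^-1.
  rewrite nh; apply: le_trans hz _; rewrite ler_pdivrMr// ler_pdivlMl//.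
  by rewrite mulr_natl.
have E := cexp_sub1Dx_le hz2.
set e := cexp (z * h%:C) in E *.
have -> : cpow (n.+2%:R / n.+1%:R) z = e by [].
have zn0 : z + n.+2%:R != 0 by exact: addn_neq0.
(* The first summand carries the second-order error of the exponential. The second is small because
   [h * (n + 2)] lies between 1 and [1 + 1 / (n + 1)]. Each is of order [1 / (n + 1)], and the
   denominator supplies the factor [1 / (n + 2)]. The constant 8 is 4 from [cexp_sub1Dx_le] times
   the bound 2 on [(n + 2) / (n + 1)]. *)
have -> : (n.+2)%:R * e / (z + n.+2%:R) - 1 =
  ((n.+2)%:R * (e - 1 - z * h%:C) + z * (h * n.+2%:R - 1)%:C) / (z + n.+2%:R).
  have -> : (h * n.+2%:R - 1)%:C = h%:C * n.+2%:R - 1 :> R[i].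
    by rewrite rmorphB rmorphM rmorph_nat.
  by clearbody e; clear -zn0; move: (n.+2%:R : R[i]) (h%:C) zn0 => a b zn0; field.
rewrite normcM normcV.
have hh : 0 <= h * n.+2%:R - 1 <= n.+1%:R^-1.
  rewrite subr_ge0 -ler_pdivrMr// div1r h1/= lerBlDr.
  apply: (@le_trans _ _ (n.+1%:R^-1 * n.+2%:R)); first by rewrite ler_pM2r.
  by rewrite -[n.+2%:R]natr1 mulrDr mulVf ?gt_eqF// mulr1 addrC.
have A : normc ((n.+2)%:R * (e - 1 - z * h%:C) + z * (h * n.+2%:R - 1)%:C) <=
   (8 * normc z ^+ 2 + normc z) * n.+1%:R^-1.
  apply: le_trans (le_normcD _ _) _; rewrite [leRHS]mulrDl lerD//; last first.
    rewrite normcM normcR ger0_norm; last by case/andP: hh.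
    by rewrite ler_wpM2l//; case/andP: hh.
  rewrite normcM normc_natr.
  apply: (@le_trans _ _ (n.+2%:R * (4 * (normc z * n.+1%:R^-1) ^+ 2))).
    rewrite ler_pM2l//; apply: le_trans E _; rewrite nh ler_pM2l ?ltr0n//.
    by rewrite lerXn2r ?nnegrE ?mulr_ge0 ?invr_ge0 ?(ltW p1).
  rewrite exprMn [_ ^-1 ^+ 2]expr2.
  have -> : n.+2%:R * (4 * (normc z ^+ 2 * (n.+1%:R^-1 * n.+1%:R^-1))) =
    4 * normc z ^+ 2 * n.+1%:R^-1 * (n.+2%:R / n.+1%:R) by ring.
  have -> : 8 * normc z ^+ 2 / n.+1%:R = 4 * normc z ^+ 2 / n.+1%:R * 2 by ring.
  rewrite ler_wpM2l ?mulr_ge0 ?sqr_ge0 ?invr_ge0 ?(ltW p1)//.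
  by rewrite ler_pdivrMr// -natrM ler_nat mul2n -addnn addnS addSn !ltnS leq_addr.
have -> : n.+1%:R^-1 - n.+2%:R^-1 = n.+1%:R^-1 * n.+2%:R^-1 :> R.
  clear -p1 p2; move: p1 p2; rewrite -[n.+2%:R]natr1; move: (n.+1%:R : R) => a p1 p2.
  by field; rewrite !gt_eqF.
rewrite mulrA ler_pM ?normc_ge0 ?invr_ge0 ?normc_ge0//.
rewrite lef_pV2 ?posrE ?normc_gt0//.
exact: normc_addn_ge.
Qed.

Lemma cgamma_cvg z : 0 < complex.Re z ->
  exists2 l : R[i], l != 0 & (gauss z : nat -> R[i]^o) @ \oo --> (l : R[i]^o).
Proof.
move=> z0.
set K := 8 * normc z ^+ 2 + normc z.
have nz := normc_ge0 z.
have K0 : 0 <= K by rewrite addr_ge0// mulr_ge0// sqr_ge0.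
(* One starting index serves two ends: [2 |z| <= N + 1] makes [gauss_ratio_near1] applicable, and
   [4 K <= N + 1] brings the telescoping total [K / (N + 1)] below 1/4. *)
have [N hN] : exists N : nat, (normc z *+ 2) + 4 * K <= N.+1%:R.
  exists (Num.truncn (normc z *+ 2 + 4 * K)).
  by apply/ltW/truncnS_gt.
pose v n := gauss z (n + N.+1)%N.
pose r n : R := K * ((n + N).+1%:R^-1 - (n + N).+2%:R^-1).
have r0 n : 0 <= r n.
  by rewrite mulr_ge0// subr_ge0 lef_pV2 ?posrE ?ltr0n// ler_nat.
have sr n : series r n <= 4^-1.
  rewrite /series/= -mulr_sumr.
  have -> : \sum_(0 <= k < n) ((k + N).+1%:R^-1 - (k + N).+2%:R^-1) =
     N.+1%:R^-1 - (n + N).+1%:R^-1 :> R.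
    elim: n => [|n IH]; first by rewrite big_geq// subrr.
    by rewrite big_nat_recr//= IH addrA subrK.
  apply: (@le_trans _ _ (K * N.+1%:R^-1)).
    by rewrite ler_wpM2l// gerBl invr_ge0.
  rewrite ler_pdivrMr// ler_pdivlMl// (le_trans _ hN)// lerDr mulrn_wge0//.
have hv n : normc (v n.+1 - v n) <= r n * normc (v n).
  rewrite /v addSn addnS gaussS// -[X in _ * _ - X]mulr1 -mulrBr normcM mulrC.
  rewrite ler_wpM2r ?normc_ge0//; apply: gauss_ratio_near1 => //.
  apply: (@le_trans _ _ (N.+1%:R)); last by rewrite ler_nat ltnS leq_addl.
  by apply: le_trans hN; rewrite lerDl mulr_ge0.
have [l l0 cl] := cvgc_quasi_constant (gauss_neq0 _ z0 : v 0%N != 0) r0 sr hv.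
exists l => //.
by rewrite -(cvg_shiftn N.+1).
Qed.

Lemma cgamma_neq0 z : 0 < complex.Re z -> cgamma z != 0.
Proof. by move=> /cgamma_cvg[l l0 /cgammaE ->]. Qed.

Lemma cgammaS z : 0 < complex.Re z -> cgamma (z + 1) = z * cgamma z.
Proof.
move=> z0; have z1 : 0 < complex.Re (z + 1) by rewrite cReD/= addr_gt0.
have [l l0 cl] := cgamma_cvg z0; rewrite (cgammaE cl).
apply: cgammaE.
(* The shift keeps the base of the powers positive, as [cpow1] requires. *)
rewrite -(cvg_shiftn 1).
(* This is the ratio [(n + 1) / (z + 1 + (n + 1))], written so that its limit 1 is visible. *)
pose w n : R[i] := (1 + - (z + 1) * ((z + 1) + n.+1%:R)^-1).
have -> : (fun n => gauss (z + 1) (n + 1)%N) = (fun n => (z : R[i]^o) * (gauss z (n + 1)%N * w n)).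
  apply/funext => n; rewrite addn1 /gauss cpowD cpow1 ?ltr0n//.
  rewrite [in LHS]big_ord_recr/= [in RHS]big_ord_recl/= addr0.
  rewrite (eq_bigr (fun i : 'I_n.+1 => z + (i.+1)%:R)); last first.
    by move=> i _; rewrite -addrA nat1r.
  have zz : z != 0 by have := addn_neq0 0 z0; rewrite addr0.
  have h1 : z + 1 + n.+1%:R != 0 by exact: addn_neq0.
  have -> : w n = n.+1%:R%:C / (z + 1 + n.+1%:R).
    by rewrite /w rmorph_nat -{1}(divff h1) -mulrDl addrC addrA addNr add0r.
  have -> : \prod_(i < n.+1) (z + (bump 0 i)%:R) = \prod_(i < n.+1) (z + i.+1%:R) by [].
  have h2 : \prod_(i < n.+1) (z + i.+1%:R) != 0.
    by apply/prodf_neq0 => i _; exact: addn_neq0.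
  rewrite !invfM; set a := (\prod_(i < n.+1) _)^-1.
  by move: (z + 1 + _)^-1 => b; clearbody a; clear -zz; field.
rewrite -[z * l](mulr1 (z * l)) -mulrA.
apply: cvgcM; first exact: cvgc_cst.
apply: cvgcM; first by rewrite (cvg_shiftn 1 (gauss z : nat -> R[i]^o)).
rewrite -[X in _ --> X]addr0; apply: cvgcD; first exact: cvgc_cst.
rewrite -(mulr0 (- (z + 1))); apply: cvgcM; first exact: cvgc_cst.
apply/cvgrPdist_le => -[e e'] e0.
move: (e0); rewrite ltcE/= => /andP[/eqP -> {}e0].
have := @cvg_harmonic R => /cvgrPdist_le/(_ e e0); apply: filterS => n.
rewrite !sub0r !normrN normc_norm lecR normcV ger0_norm ?invr_ge0//.
apply: le_trans; rewrite /harmonic lef_pV2 ?posrE ?ltr0n ?normc_gt0 ?addn_neq0//.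
exact: normc_addn_ge.
Qed.

Lemma pochhammerS z m : 0 < complex.Re z ->
  pochhammer z m.+1 = pochhammer z m * (z + m%:R).
Proof.
move=> z0; rewrite /pochhammer -[m.+1%:R]natr1 addrA cgammaS; last first.
  by rewrite cReD Re_nat ltr_wpDr.
case: m => [|m]; first by rewrite addr0 mulfK ?cgamma_neq0// mul1r.
by rewrite -mulrA mulrC.
Qed.

Lemma pochhammer_neq0 z m : 0 < complex.Re z -> pochhammer z m != 0.
Proof.
move=> z0; elim: m => [|m IH]; first by rewrite /= oner_eq0.
by rewrite pochhammerS// mulf_neq0// addn_neq0.
Qed.

End cgamma.

(** * The beta integral *)

Section real_integration.
Variable R : realType.
Local Notation mu := (@lebesgue_measure R).

Lemma is_derive_continuous (F : R -> R) (t d : R) :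
  is_derive t 1 F d -> {for t, continuous F}.
Proof.
by move=> [h _]; apply: differentiable_continuous; exact/derivable1_diffP.
Qed.

Lemma FTC2_is_derive (F f : R -> R) (a b : R) : a < b ->
  (forall t, a <= t <= b -> is_derive t (1 : R) F (f t)) ->
  (forall t, a <= t <= b -> {for t, continuous f}) ->
  (\int[mu]_(t in `[a, b]) (f t)%:E)%E = (F b - F a)%:E.
Proof.
move=> ab dF cf; rewrite EFinB; apply: continuous_FTC2 => //.
- apply: continuous_in_subspaceT => t; rewrite inE/= in_itv/=; exact: cf.
- split.
  + move=> t; rewrite in_itv/= => /andP[/ltW at_ /ltW tb].
    by have [] : is_derive t (1 : R) F (f t) by apply: dF; rewrite at_.
  + apply: cvg_at_right_filter; apply: is_derive_continuous.
    by apply: (dF a); rewrite lexx ltW.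
  + apply: cvg_at_left_filter; apply: is_derive_continuous.
    by apply: (dF b); rewrite lexx ltW.
- move=> t; rewrite in_itv/= => /andP[/ltW at_ /ltW tb].
  rewrite derive1E; have := dF t; rewrite at_ tb => /(_ isT) h.
  exact: derive_val.
Qed.

(** By monotone convergence, a bound uniform over an exhausting sequence passes to the whole set.
    This deals with singular endpoints: antiderivatives and substitutions are used on compact
    subintervals only. *)
Lemma ge0_integral_exhaustion_le (D : set R) (J : nat -> set R) (h : R -> R) (C : \bar R) :
  measurable (D : set (measurableTypeR R)) ->
  (forall n, measurable (J n : set (measurableTypeR R))) ->
  measurable_fun D h -> (forall t, D t -> 0 <= h t) ->
  (forall m n, (m <= n)%N -> J m `<=` J n) ->
  (forall t, D t -> exists n, J n t) ->
  (forall n, (\int[mu]_(t in D `&` J n) (h t)%:E <= C)%E) ->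
  (\int[mu]_(t in D) (h t)%:E <= C)%E.
Proof.
move=> mD mJ mh h0 ndJ cJ hC.
pose g n t := ((EFin \o h) \_ (J n)) t.
have gE n t : g n t = if t \in J n then (h t)%:E else 0%E by rewrite /g patchE.
have lim_g t : D t -> limn (g ^~ t) = (h t)%:E.
  move=> /cJ[N JN]; apply: cvg_lim => //.
  apply: cvg_near_cst; exists N => // n /= Nn.
  by rewrite gE mem_set//; exact: (ndJ N).
have -> : (\int[mu]_(t in D) (h t)%:E = \int[mu]_(t in D) limn (g ^~ t))%E.
  by apply: eq_integral => t /set_mem Dt; rewrite lim_g.
have mg n : measurable_fun D (g n).
  apply/(measurable_restrict _ (mJ n) mD).
  by apply/measurable_EFinP; exact: measurable_funS mh.
have g0 n t : D t -> (0 <= g n t)%E.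
  by move=> Dt; rewrite gE; case: ifP => // _; rewrite lee_fin h0.
have ndg t : D t -> {homo g ^~ t : m n / (m <= n)%N >-> (m <= n)%E}.
  move=> Dt m n mn; rewrite !gE; case: ifPn => [/set_mem Jm|_].
    by rewrite mem_set//; exact: (ndJ m).
  by case: ifP => // _; rewrite lee_fin h0.
have := @cvg_monotone_convergence _ _ _ mu D mD g mg g0 ndg.
move=> /cvg_lim <- //; apply: lime_le.
  by apply/cvg_ex; eexists; exact: cvg_monotone_convergence.
by apply: nearW => n; rewrite /g -integral_mkcondr.
Qed.

End real_integration.

Section beta_weight.
Variable R : realType.
Local Notation mu := (@lebesgue_measure R).
Local Notation D := (`]0, 1[%classic : set R).
Implicit Types (a b c t : R) (x y : R[i]).

Let mD : measurable (D : set (measurableTypeR R)).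
Proof. exact: measurable_itv. Qed.

Definition bweight a b t : R := t `^ (a - 1) * (1 - t) `^ (b - 1).

Lemma bweight_ge0 a b t : 0 <= bweight a b t.
Proof. by rewrite mulr_ge0 ?powR_ge0. Qed.

Lemma measurable_onem_powR a : measurable_fun [set: R] (fun t : R => (1 - t) `^ a).
Proof.
apply: (measurableT_comp (measurable_powR a)).
by apply: measurable_funB => //; exact: measurable_cst.
Qed.

Lemma measurable_powRS (A : set R) a : measurable_fun A (fun t : R => t `^ a).
Proof. by have h := @measurable_powR R a; exact: measurable_funS h. Qed.

Lemma measurable_onem_powRS (A : set R) a : measurable_fun A (fun t : R => (1 - t) `^ a).
Proof. by have h := measurable_onem_powR a; exact: measurable_funS h. Qed.

Lemma measurable_bweight a b : measurable_fun [set: R] (bweight a b).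
Proof.
by apply: measurable_funM; [exact: measurable_powR|exact: measurable_onem_powR].
Qed.

(** One bound for both signs of [c]: the power is at most the larger of its values at the two ends,
    hence at most their sum. *)
Lemma powR_half_le c t : 2^-1 <= t <= 1 -> t `^ c <= 1 + 2^-1 `^ c.
Proof.
move=> /andP[t2 t1]; have t0 : 0 < t by apply: lt_le_trans t2.
have [c0|c0] := leP 0 c.
  apply: (@le_trans _ _ 1); last by rewrite lerDl powR_ge0.
  rewrite [leRHS](_ : 1 = 1 `^ c); last by rewrite powR1.
  by rewrite ge0_ler_powR// nnegrE ltW.
apply: (@le_trans _ _ (2^-1 `^ c)); last by rewrite lerDr.
rewrite -(opprK c) 2!(powRN _ (- c)) lef_pV2 ?posrE ?powR_gt0//.
by rewrite ge0_ler_powR ?nnegrE ?oppr_ge0 ?(ltW c0) ?(ltW t0).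
Qed.

Lemma continuous_powR c t : 0 < t -> {for t, continuous (fun s => s `^ c)}.
Proof. by move=> t0; apply: is_derive_continuous; exact: is_derive1_powR. Qed.

Lemma is_derive_onem t : is_derive t 1 (fun s : R => 1 - s) (-1).
Proof.
have -> : (fun s : R => 1 - s) = cst 1 - id by [].
have -> : (-1 : R) = 0 - 1 by rewrite sub0r.
exact: is_deriveB.
Qed.

Lemma is_derive_onem_powR c t : 0 < 1 - t ->
  is_derive t 1 (fun s : R => (1 - s) `^ c) (c * (1 - t) `^ (c - 1) * -1).
Proof.
move=> t1; apply: (@is_derive1_comp R (fun s => s `^ c) (fun s => 1 - s)).
  exact: is_derive1_powR.
exact: is_derive_onem.
Qed.

(** The offset 3 keeps these numbers strictly below 1/2, so that removing such a margin at each end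
    of the unit interval never leaves a degenerate interval. *)
Lemma exists_invn_le t : 0 < t -> exists n, n.+3%:R^-1 <= t.
Proof.
move=> t0; exists (Num.truncn t^-1).
rewrite -[leRHS]invrK lef_pV2 ?posrE ?invr_gt0 ?ltr0n//.
apply: le_trans (ltW (truncnS_gt _)) _.
by rewrite ler_nat ltnS leqW.
Qed.

Lemma invn_le m n : (m <= n)%N -> n.+3%:R^-1 <= m.+3%:R^-1 :> R.
Proof. by move=> mn; rewrite lef_pV2 ?posrE ?ltr0n// ler_nat !ltnS. Qed.

Lemma invn_lt_half n : n.+3%:R^-1 < 2^-1 :> R.
Proof. by rewrite ltf_pV2 ?posrE ?ltr0n// ltr_nat. Qed.

Lemma integral_powR_le a : 0 < a ->
  (\int[mu]_(t in D) (t `^ (a - 1))%:E <= (a^-1)%:E)%E.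
Proof.
move=> a0.
apply: (@ge0_integral_exhaustion_le R D (fun n => `[n.+3%:R^-1, 1]%classic)) => //.
- exact: measurable_powRS.
- by move=> t _; exact: powR_ge0.
- move=> m n mn t; rewrite /= !in_itv/= => /andP[h ->]; rewrite andbT.
  by apply: le_trans h; exact: invn_le.
- move=> t; rewrite /= in_itv/= => /andP[t0 t1].
  have [n hn] := exists_invn_le t0.
  by exists n; rewrite /= in_itv/= hn ltW.
move=> n.
have e0 : 0 < n.+3%:R^-1 :> R by rewrite invr_gt0 ltr0n.
have h : (\int[mu]_(t in D `&` `[(n.+3%:R^-1)%R, 1%R]) (t `^ (a - 1))%:E <=
    \int[mu]_(t in `[(n.+3%:R^-1)%R, 1%R]) (t `^ (a - 1))%:E)%E.
  apply: ge0_subset_integral => //.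
  - by apply: measurableI => //; exact: measurable_itv.
  - by apply/measurable_EFinP; exact: measurable_powRS.
  - by move=> t _; rewrite lee_fin powR_ge0.
apply: (le_trans h).
have hd t : n.+3%:R^-1 <= t <= 1 ->
    is_derive t (1 : R) (fun t => a^-1 * t `^ a) (t `^ (a - 1)).
  move=> /andP[te _]; have t0 : 0 < t by apply: lt_le_trans te.
  have -> : t `^ (a - 1) = a^-1 *: (a * t `^ (a - 1)).
    by rewrite /GRing.scale/= mulrA mulVf ?mul1r// gt_eqF.
  by apply: is_deriveZ; exact: is_derive1_powR.
have hc t : n.+3%:R^-1 <= t <= 1 -> {for t, continuous (fun t => t `^ (a - 1))}.
  by move=> /andP[te _]; apply: continuous_powR; apply: lt_le_trans te.
have hab : n.+3%:R^-1 < 1 :> R.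
  by apply: lt_trans (invn_lt_half n) _; rewrite invf_lt1// ltr1n.
rewrite (FTC2_is_derive hab hd hc) lee_fin powR1 mulr1 gerBl mulr_ge0 ?powR_ge0//.
by rewrite invr_ge0 ltW.
Qed.

Lemma integral_onem_powR_le a : 0 < a ->
  (\int[mu]_(t in D) ((1 - t) `^ (a - 1))%:E <= (a^-1)%:E)%E.
Proof.
move=> a0.
apply: (@ge0_integral_exhaustion_le R D (fun n => `[0, 1 - n.+3%:R^-1]%classic)) => //.
- exact: measurable_onem_powRS.
- by move=> t _; exact: powR_ge0.
- move=> m n mn t; rewrite /= !in_itv/= => /andP[-> h] /=.
  by apply: le_trans h _; rewrite lerD2l lerN2; exact: invn_le.
- move=> t; rewrite /= in_itv/= => /andP[t0 t1].
  have [|n hn] := @exists_invn_le (1 - t); first by rewrite subr_gt0.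
  by exists n; rewrite /= in_itv/= ltW//= lerBrDr addrC -lerBrDr.
move=> n.
have e0 : 0 < n.+3%:R^-1 :> R by rewrite invr_gt0 ltr0n.
have e2 := invn_lt_half n.
have h : (\int[mu]_(t in D `&` `[0%R, (1 - n.+3%:R^-1)%R]) ((1 - t) `^ (a - 1))%:E <=
    \int[mu]_(t in `[0%R, (1 - n.+3%:R^-1)%R]) ((1 - t) `^ (a - 1))%:E)%E.
  apply: ge0_subset_integral => //.
  - by apply: measurableI => //; exact: measurable_itv.
  - by apply/measurable_EFinP; exact: measurable_onem_powRS.
  - by move=> t _; rewrite lee_fin powR_ge0.
apply: (le_trans h).
have pos (t : R) : 0 <= t <= 1 - n.+3%:R^-1 -> 0 < 1 - t by move=> /andP[_ ht]; rewrite subr_gt0; apply: le_lt_trans ht _; rewrite gtrBl.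
have hd t : 0 <= t <= 1 - n.+3%:R^-1 ->
    is_derive t (1 : R) (fun t => - a^-1 * (1 - t) `^ a) ((1 - t) `^ (a - 1)).
  move=> /pos t0.
  have -> : (1 - t) `^ (a - 1) = (- a^-1) *: (a * (1 - t) `^ (a - 1) * -1).
    by rewrite /GRing.scale/= mulrN1 mulrNN mulrA mulVf ?mul1r// gt_eqF.
  by apply: is_deriveZ; exact: is_derive_onem_powR.
have hc t : 0 <= t <= 1 - n.+3%:R^-1 ->
    {for t, continuous (fun t => (1 - t) `^ (a - 1))}.
  by move=> /pos t0; exact: is_derive_continuous (is_derive_onem_powR _ t0).
have hab : 0 < 1 - n.+3%:R^-1 :> R.
  by rewrite subr_gt0; apply: lt_trans e2 _; rewrite invf_lt1// ltr1n.
rewrite (FTC2_is_derive hab hd hc) lee_fin subr0 powR1 mulr1 !mulNr opprK.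
by rewrite addrC gerBl mulr_ge0 ?powR_ge0// invr_ge0 ltW.
Qed.

Lemma integrable_ge0_le (h : R -> R) (C : R) : measurable_fun D h ->
  (forall t, 0 <= h t) -> (\int[mu]_(t in D) (h t)%:E <= C%:E)%E ->
  mu.-integrable D (EFin \o h).
Proof.
move=> mh h0 hC; apply/integrableP; split; first exact/measurable_EFinP.
under eq_integral do rewrite gee0_abs ?lee_fin//.
exact: le_lt_trans hC (ltry _).
Qed.

(** On each half of the interval, the factor that is singular at the other end is bounded by
    [powR_half_le]; the weight is thus below a combination of two one-sided powers. *)
Lemma bweight_integrable a b : 0 < a -> 0 < b ->
  mu.-integrable D (EFin \o bweight a b).
Proof.
move=> a0 b0.
have ia : mu.-integrable D (EFin \o (fun t => t `^ (a - 1))).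
  apply: integrable_ge0_le (integral_powR_le a0) => //.
  - exact: measurable_powRS.
  - by move=> t; exact: powR_ge0.
have ib : mu.-integrable D (EFin \o (fun t => (1 - t) `^ (b - 1))).
  apply: integrable_ge0_le (integral_onem_powR_le b0) => //.
  - exact: measurable_onem_powRS.
  - by move=> t; exact: powR_ge0.
have ic := integrableD mD (integrableZl mD (1 + 2^-1 `^ (b - 1)) ia)
  (integrableZl mD (1 + 2^-1 `^ (a - 1)) ib).
apply: le_integrable ic => //.
  by apply/measurable_EFinP/measurable_funTS; exact: measurable_bweight.
move=> t; rewrite /= in_itv/= => /andP[t0 t1].
rewrite lee_fin ger0_norm ?bweight_ge0//.
apply: le_trans (ler_norm _); rewrite /bweight.
have pa := powR_ge0 t (a - 1); have pb := powR_ge0 (1 - t) (b - 1).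
have qa : 0 <= 1 + 2^-1 `^ (a - 1) :> R by rewrite addr_ge0 ?powR_ge0.
have qb : 0 <= 1 + 2^-1 `^ (b - 1) :> R by rewrite addr_ge0 ?powR_ge0.
have [t2|t2] := leP t 2^-1.
  apply: (@le_trans _ _ ((1 + 2^-1 `^ (b - 1)) * t `^ (a - 1))).
    by rewrite mulrC ler_wpM2r// powR_half_le//; lra.
  by rewrite lerDl mulr_ge0.
apply: (@le_trans _ _ ((1 + 2^-1 `^ (a - 1)) * (1 - t) `^ (b - 1))).
  by rewrite ler_wpM2r// powR_half_le//; lra.
by rewrite lerDr mulr_ge0.
Qed.

End beta_weight.

(** * Recursions of the beta integral for complex arguments *)

Section complex_beta.
Variable R : realType.
Local Notation mu := (@lebesgue_measure R).
Local Notation D := (`]0, 1[%classic : set R).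
Implicit Types (a b c t : R) (x y : R[i]).

Let mD : measurable (D : set (measurableTypeR R)).
Proof. exact: measurable_itv. Qed.

Lemma normc_cpow_onem x y t : 0 < t < 1 ->
  normc (cpow t x * cpow (1 - t) y) = t `^ complex.Re x * (1 - t) `^ complex.Re y.
Proof.
by move=> /andP[t0 t1]; rewrite normcM !normc_cpow// subr_gt0.
Qed.

Lemma normc_beta_integrand x y t : 0 < t < 1 ->
  normc (cpow t (x - 1) * cpow (1 - t) (y - 1)) =
  bweight (complex.Re x) (complex.Re y) t.
Proof. by move=> t01; rewrite normc_cpow_onem// !cReD !cReN. Qed.

Lemma cmeas_cpow_onem x y : cmeas [set: R] (fun t => cpow t x * cpow (1 - t) y).
Proof.
apply: cmeasM; apply: cmeas_cpow; first exact: measurable_id.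
by apply: measurable_funB => //; exact: measurable_cst.
Qed.

Lemma cbeta_integrable x y : 0 < complex.Re x -> 0 < complex.Re y ->
  cintegrable01 (fun t => cpow t (x - 1) * cpow (1 - t) (y - 1)).
Proof.
move=> x0 y0; apply: (cintegrable01_le _ (bweight_integrable x0 y0)).
  by apply: cmeasS; exact: cmeas_cpow_onem.
by move=> t /normc_beta_integrand ->.
Qed.

Lemma is_derive_ReIm_cexp (p q : R -> R) (t p' q' : R) :
  is_derive t 1 p p' -> is_derive t 1 q q' ->
  is_derive t 1 (fun s => expR (p s) * cos (q s))
    (complex.Re ((p' +i* q') * cexp (p t +i* q t))) /\
  is_derive t 1 (fun s => expR (p s) * sin (q s))
    (complex.Im ((p' +i* q') * cexp (p t +i* q t))).
Proof.
move=> hp hq.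
have he : is_derive t 1 (fun s => expR (p s)) (expR (p t) * p').
  exact: (@is_derive1_comp R expR p).
have hc : is_derive t 1 (fun s => cos (q s)) (- sin (q t) * q').
  exact: (@is_derive1_comp R cos q).
have hs : is_derive t 1 (fun s => sin (q s)) (cos (q t) * q').
  exact: (@is_derive1_comp R sin q).
rewrite cReM cImM Re_cexp Im_cexp /=; split.
- rewrite [X in is_derive _ _ _ X](_ : _ =
    expR (p t) *: (- sin (q t) * q') + cos (q t) *: (expR (p t) * p')).
    exact: is_deriveM.
  by rewrite /GRing.scale/=; ring.
- rewrite [X in is_derive _ _ _ X](_ : _ =
    expR (p t) *: (cos (q t) * q') + sin (q t) *: (expR (p t) * p')).
    exact: is_deriveM.
  by rewrite /GRing.scale/=; ring.
Qed.

(** The function is the exponential of [x ln s + y ln (1 - s)], with logarithmic derivative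
    [x / t - y / (1 - t)] at [t]; in [K] the two quotients are absorbed into the exponents. *)
Lemma is_derive_cpow_onem x y t : 0 < t < 1 ->
  let K := x * (cpow t (x - 1) * cpow (1 - t) y) -
           y * (cpow t x * cpow (1 - t) (y - 1)) in
  is_derive t 1 (fun s => complex.Re (cpow s x * cpow (1 - s) y)) (complex.Re K) /\
  is_derive t 1 (fun s => complex.Im (cpow s x * cpow (1 - s) y)) (complex.Im K).
Proof.
move=> /andP[t0 t1]; have t1' : 0 < 1 - t by rewrite subr_gt0.
have hl (c d : R) : is_derive t 1 (fun s => c * ln s + d * ln (1 - s))
   (c * t^-1 - d * (1 - t)^-1).
  have h1 : is_derive t (1 : R) (fun s : R => ln (1 - s)) ((1 - t)^-1 * -1).
    apply: (@is_derive1_comp R (@ln R) (fun s => 1 - s)).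
      exact: is_derive1_ln.
    exact: is_derive_onem.
  have h2 : is_derive t (1 : R) (@ln R) t^-1 by exact: is_derive1_ln.
  rewrite [X in is_derive _ _ _ X](_ : _ = c *: t^-1 + d *: ((1 - t)^-1 * -1)).
    by apply: is_deriveD.
  by rewrite /GRing.scale/= mulrN1 mulrN.
have [h1 h2] := is_derive_ReIm_cexp (hl (complex.Re x) (complex.Re y))
  (hl (complex.Im x) (complex.Im y)).
have e s : x * (ln s)%:C + y * (ln (1 - s))%:C =
   (complex.Re x * ln s + complex.Re y * ln (1 - s)) +i*
   (complex.Im x * ln s + complex.Im y * ln (1 - s)).
  case: (x) (y) => a b [c d]; apply/eqP; rewrite eq_complex/=.
  by apply/andP; split; apply/eqP; ring.
have eK : (complex.Re x * t^-1 - complex.Re y * (1 - t)^-1) +i*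
   (complex.Im x * t^-1 - complex.Im y * (1 - t)^-1) =
   x * (t^-1)%:C - y * ((1 - t)^-1)%:C.
  case: (x) (y) => a b [c d]; apply/eqP; rewrite eq_complex/=.
  by apply/andP; split; apply/eqP; ring.
have cK : x * (cpow t (x - 1) * cpow (1 - t) y) -
           y * (cpow t x * cpow (1 - t) (y - 1)) =
   (x * (t^-1)%:C - y * ((1 - t)^-1)%:C) * cexp (x * (ln t)%:C + y * (ln (1 - t))%:C).
  rewrite cexpD -/(cpow t x) -/(cpow (1 - t) y).
  have d1 z : cpow t (z - 1) = cpow t z * (t^-1)%:C.
    rewrite -{2}(subrK 1 z) cpowS// -mulrA -rmorphM mulfV ?gt_eqF//.
    by rewrite mulr1.
  have d2 z : cpow (1 - t) (z - 1) = cpow (1 - t) z * ((1 - t)^-1)%:C.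
    rewrite -{2}(subrK 1 z) cpowS// -mulrA -rmorphM mulfV ?gt_eqF//.
    by rewrite mulr1.
  rewrite d1 d2; ring.
move=> K; rewrite {}/K cK -eK e; split.
- rewrite (_ : (fun s => complex.Re _) = (fun s => expR (complex.Re x * ln s + complex.Re y * ln (1 - s)) * cos (complex.Im x * ln s + complex.Im y * ln (1 - s)))) //.
  by apply/funext => s; rewrite -cexpD e Re_cexp.
- rewrite (_ : (fun s => complex.Im _) = (fun s => expR (complex.Re x * ln s + complex.Re y * ln (1 - s)) * sin (complex.Im x * ln s + complex.Im y * ln (1 - s)))) //.
  by apply/funext => s; rewrite -cexpD e Im_cexp.
Qed.

Lemma cpow_onem_continuous x y t : 0 < t < 1 ->
  {for t, continuous (fun s => complex.Re (cpow s x * cpow (1 - s) y))} /\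
  {for t, continuous (fun s => complex.Im (cpow s x * cpow (1 - s) y))}.
Proof.
move=> /(is_derive_cpow_onem x y)[h1 h2]; split.
- exact: is_derive_continuous h1.
- exact: is_derive_continuous h2.
Qed.

(** The bound by [t ^ a (1 - t) ^ b] makes [F] vanish at both ends. The integrals over [[e, 1 - e]]
    equal [F (1 - e) - F e], which tends to 0, and they converge to the full integral by domination
    with [|f|]. *)
Lemma Rintegral_derive_eq0 (F f : R -> R) a b : 0 < a -> 0 < b ->
  (forall t, 0 < t < 1 -> is_derive t (1 : R) F (f t)) ->
  (forall t, 0 < t < 1 -> {for t, continuous f}) ->
  mu.-integrable D (EFin \o f) ->
  (forall t, 0 < t < 1 -> `|F t| <= t `^ a * (1 - t) `^ b) ->
  Rintegral mu D f = 0.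
Proof.
move=> a0 b0 dF cf if_ Fb.
pose e n : R := n.+3%:R^-1.
have e0 n : 0 < e n by rewrite invr_gt0 ltr0n.
have e2 n : e n < 2^-1 by exact: invn_lt_half.
pose J n := `[e n, 1 - e n]%classic.
have JD n : J n `<=` D.
  move=> t; rewrite /J /= !in_itv/= => /andP[h1 h2]; apply/andP; split.
    exact: lt_le_trans h1.
  by apply: le_lt_trans h2 _; rewrite gtrBl.
have mJ n : measurable (J n : set (measurableTypeR R)) by exact: measurable_itv.
have mf : measurable_fun D f by apply/measurable_EFinP; exact: measurable_int if_.
have [|||_ h] := @Rintegral_dominated_cvg R D (fun n => f \_ (J n)) f (fun t => `|f t|) mD _ _ (integrable_norm if_) _.
- move=> n; apply/(measurable_restrict _ (mJ n) mD).
  by apply: measurable_funS mf => //; exact: subIsetl.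
- move=> t; rewrite /= in_itv/= => /andP[t0 t1].
  have [n1 hn1] := exists_invn_le t0.
  have [|n2 hn2] := @exists_invn_le R (1 - t); first by rewrite subr_gt0.
  apply: cvg_near_cst; exists (maxn n1 n2) => // n /=; rewrite geq_max => /andP[h1 h2].
  rewrite patchE mem_set// /J /= in_itv/= (le_trans (invn_le R h1) hn1)/=.
  by rewrite lerBrDr addrC -lerBrDr (le_trans (invn_le R h2) hn2).
- by move=> n t _; rewrite patchE; case: ifP => // _; rewrite normr0.
have hJ n : Rintegral mu D (f \_ (J n)) = F (1 - e n) - F (e n).
  rewrite -Rintegral_mkcondr setIidr//.
  have sub t : e n <= t <= 1 - e n -> 0 < t < 1.
    by move=> ht; have := JD n t; rewrite /J /= !in_itv/=; exact.
  have ab : e n < 1 - e n by have := e2 n; lra.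
  by rewrite /Rintegral (FTC2_is_derive ab (fun t ht => dF t (sub t ht))
    (fun t ht => cf t (sub t ht))).
have ce : e @ \oo --> 0.
  have := @cvg_harmonic R; rewrite -(cvg_shiftn 2) /harmonic.
  by under eq_fun do rewrite addn2.
have cp c : 0 < c -> (fun n => e n `^ c) @ \oo --> 0.
  by move=> /(@powR_cvg0 R)/cvg_at_rightP; apply; split.
have cF : (fun n => F (1 - e n) - F (e n)) @ \oo --> (0 : R).
  apply/norm_cvg0P; apply: (@squeeze_cvgr _ _ _ _ (cst 0) (fun n => e n `^ b + e n `^ a)).
  - apply: nearW => n; rewrite normr_ge0/=.
    have h1 : 0 <= 1 - e n <= 1 by have := e2 n; have := e0 n; lra.
    have le1 c : 0 < c -> (1 - e n) `^ c <= 1.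
      move=> c0; have /andP[h3 h4] := h1.
      rewrite [leRHS](_ : 1 = 1 `^ c); last by rewrite powR1.
      by rewrite ge0_ler_powR ?nnegrE// ltW.
    apply: le_trans (ler_normB _ _) _; apply: lerD.
      have /Fb : 0 < 1 - e n < 1 by have := e2 n; have := e0 n; lra.
      rewrite [1 - (1 - e n)](_ : _ = e n); last by ring.
      move=> h3; apply: le_trans h3 _.
      by rewrite ler_piMl ?powR_ge0// le1.
    have /Fb h3 : 0 < e n < 1 by have := e2 n; have := e0 n; lra.
    by apply: le_trans h3 _; rewrite ler_piMr ?powR_ge0// le1.
  - exact: cvg_cst.
  - by rewrite -[X in _ --> X](addr0 0); apply: cvgD; exact: cp.
apply: (cvg_unique _ h); first exact: norm_hausdorff.
by rewrite (_ : (fun n => Rintegral _ _ _) = (fun n => F (1 - e n) - F (e n)))//; apply/funext.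
Qed.

(** The two sides differ by the integral of the derivative of [t ^ x (1 - t) ^ y], a function that
    vanishes at both ends. *)
Lemma cbeta_ibp x y : 0 < complex.Re x -> 0 < complex.Re y ->
  x * cbeta x (y + 1) = y * cbeta (x + 1) y.
Proof.
move=> x0 y0.
have x1 : 0 < complex.Re (x + 1) by rewrite cReD/= addr_gt0.
have y1 : 0 < complex.Re (y + 1) by rewrite cReD/= addr_gt0.
have i1 := cintegrable01Z x (cbeta_integrable x0 y1).
have i2 := cintegrable01Z (- y) (cbeta_integrable x1 y0).
apply/eqP; rewrite -subr_eq0 -mulNr /cbeta.
rewrite -cint01Z; last exact: cbeta_integrable.
rewrite -cint01Z; last exact: cbeta_integrable.
rewrite -cint01D//.
pose K t := x * (cpow t (x - 1) * cpow (1 - t) y) -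
           y * (cpow t x * cpow (1 - t) (y - 1)).
have eK t : x * (cpow t (x - 1) * cpow (1 - t) (y + 1 - 1)) +
    - y * (cpow t (x + 1 - 1) * cpow (1 - t) (y - 1)) = K t.
  by rewrite /K !addrK mulNr.
have [iR iI] := eq_cintegrable01 (fun t _ => eK t) (cintegrable01D i1 i2).
rewrite (eq_cint01 (fun t _ => eK t)) /cint01.
have cont t : 0 < t < 1 -> forall z w : R[i],
  {for t, continuous (fun s => complex.Re (z * (cpow s (x - 1) * cpow (1 - s) y) - w * (cpow s x * cpow (1 - s) (y - 1))))} /\
  {for t, continuous (fun s => complex.Im (z * (cpow s (x - 1) * cpow (1 - s) y) - w * (cpow s x * cpow (1 - s) (y - 1))))}.
  move=> t01 z w.
  have [a1 a2] := cpow_onem_continuous (x - 1) y t01.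
  have [b1 b2] := cpow_onem_continuous x (y - 1) t01.
  set f := fun s => cpow s (x - 1) * cpow (1 - s) y.
  set g := fun s => cpow s x * cpow (1 - s) (y - 1).
  split.
  - rewrite (_ : (fun s => _) = (fun s =>
      (complex.Re z * complex.Re (f s) - complex.Im z * complex.Im (f s)) -
      (complex.Re w * complex.Re (g s) - complex.Im w * complex.Im (g s)))).
      by apply: cvgB; apply: cvgB; apply: cvgM => //; exact: cvg_cst.
    by apply/funext => s; rewrite cReD cReN -/(f s) -/(g s) !cReM.
  - rewrite (_ : (fun s => _) = (fun s =>
      (complex.Re z * complex.Im (f s) + complex.Im z * complex.Re (f s)) -
      (complex.Re w * complex.Im (g s) + complex.Im w * complex.Re (g s)))).
      by apply: cvgB; apply: cvgD; apply: cvgM => //; exact: cvg_cst.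
    by apply/funext => s; rewrite cImD cImN -/(f s) -/(g s) !cImM.
have bR t : 0 < t < 1 -> `|complex.Re (cpow t x * cpow (1 - t) y)| <=
    t `^ complex.Re x * (1 - t) `^ complex.Re y.
  by move=> t01; rewrite -normc_cpow_onem// normr_Re_le.
have bI t : 0 < t < 1 -> `|complex.Im (cpow t x * cpow (1 - t) y)| <=
    t `^ complex.Re x * (1 - t) `^ complex.Re y.
  by move=> t01; rewrite -normc_cpow_onem// normr_Im_le.
rewrite (Rintegral_derive_eq0 x0 y0 (fun t h => (is_derive_cpow_onem x y h).1)
  (fun t h => (cont t h x y).1) iR bR).
by rewrite (Rintegral_derive_eq0 x0 y0 (fun t h => (is_derive_cpow_onem x y h).2)
  (fun t h => (cont t h x y).2) iI bI).
Qed.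

(** Inserting [1 = t + (1 - t)] under the integral. *)
Lemma cbeta_split x y : 0 < complex.Re x -> 0 < complex.Re y ->
  cbeta (x + 1) y + cbeta x (y + 1) = cbeta x y.
Proof.
move=> x0 y0.
have x1 : 0 < complex.Re (x + 1) by rewrite cReD/= addr_gt0.
have y1 : 0 < complex.Re (y + 1) by rewrite cReD/= addr_gt0.
rewrite /cbeta -cint01D; [|exact: cbeta_integrable|exact: cbeta_integrable].
apply: eq_cint01 => t /andP[t0 t1]; have t1' : 0 < 1 - t by rewrite subr_gt0.
rewrite !addrK.
have -> : cpow t x = cpow t (x - 1) * t%:C by rewrite -{1}(subrK 1 x) cpowS.
have -> : cpow (1 - t) y = cpow (1 - t) (y - 1) * (1 - t)%:C by rewrite -{1}(subrK 1 y) cpowS.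
rewrite rmorphB/=; ring.
Qed.

Lemma cbetaSl x y : 0 < complex.Re x -> 0 < complex.Re y ->
  (x + y) * cbeta (x + 1) y = x * cbeta x y.
Proof.
by move=> x0 y0; rewrite -[in RHS](cbeta_split x0 y0) mulrDr cbeta_ibp// mulrDl.
Qed.

Lemma cbetaSr x y : 0 < complex.Re x -> 0 < complex.Re y ->
  (x + y) * cbeta x (y + 1) = y * cbeta x y.
Proof.
move=> x0 y0; rewrite -[in RHS](cbeta_split x0 y0) mulrDr -cbeta_ibp// mulrDl.
by rewrite addrC.
Qed.

(** Induction with [cbetaSl], each step dividing by [x + y + m], whose real part is positive. The
    quotient of Pochhammer symbols thus arises without expressing the beta integral by Gamma. *)
Lemma cbeta_pochhammer x y m : 0 < complex.Re x -> 0 < complex.Re y ->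
  cbeta (x + m%:R) y = pochhammer x m / pochhammer (x + y) m * cbeta x y.
Proof.
move=> x0 y0; have xy0 : 0 < complex.Re (x + y) by rewrite cReD addr_gt0.
elim: m => [|m IH]; first by rewrite addr0 /= divr1 mul1r.
have xm0 : 0 < complex.Re (x + m%:R) by rewrite cReD Re_nat ltr_wpDr.
have n0 : x + y + m%:R != 0 by exact: addn_neq0.
rewrite -[m.+1%:R]natr1 addrA; apply: (mulfI n0).
rewrite [X in X * _ = _]addrAC cbetaSl// IH !pochhammerS// invfM.
have p0 := pochhammer_neq0 m xy0.
by field; rewrite n0.
Qed.

End complex_beta.

(** * Nonvanishing of the beta integral for complex arguments *)

Section cbeta_nonvanishing.
Variable R : realType.
Local Notation mu := (@lebesgue_measure R).
Local Notation D := (`]0, 1[%classic : set R).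
Implicit Types (x y : R[i]).

Let mD : measurable (D : set (measurableTypeR R)).
Proof. exact: measurable_itv. Qed.

(** The second argument is raised by [cbetaSr], then the first by [cbetaSl]; each time the factor on
    the left has positive real part and can be cancelled. *)
Lemma cbeta_eq0_shift x y n : 0 < complex.Re x -> 0 < complex.Re y ->
  cbeta x y = 0 -> cbeta (x + n%:R) (y + n%:R) = 0.
Proof.
move=> x0 y0 b0; elim: n => [|n IH]; first by rewrite !addr0.
have xn : 0 < complex.Re (x + n%:R) by rewrite cReD Re_nat ltr_wpDr.
have yn : 0 < complex.Re (y + n%:R) by rewrite cReD Re_nat ltr_wpDr.
have yn1 : 0 < complex.Re (y + n%:R + 1) by rewrite cReD/= addr_gt0.
rewrite -natr1 !addrA.
have h1 : cbeta (x + n%:R) (y + n%:R + 1) = 0.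
  have := cbetaSr xn yn; rewrite IH mulr0 => /eqP; rewrite mulf_eq0.
  have := @addn_neq0 R (x + n%:R + (y + n%:R)) 0 _; rewrite addr0.
  move=> h; have /h/negPf -> : 0 < complex.Re (x + n%:R + (y + n%:R)).
    by rewrite cReD addr_gt0.
  by move=> /eqP.
have := cbetaSl xn yn1; rewrite h1 mulr0 => /eqP; rewrite mulf_eq0.
have := @addn_neq0 R (x + n%:R + (y + n%:R + 1)) 0 _; rewrite addr0.
move=> h; have /h/negPf -> : 0 < complex.Re (x + n%:R + (y + n%:R + 1)).
  by rewrite cReD addr_gt0.
by move=> /eqP.
Qed.

(* The kernel [(t (1 - t)) ^ n] concentrates at [1/2], where [phi] is positive. *)
Lemma concentration (phi : R -> R) : mu.-integrable D (EFin \o phi) ->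
  0 < phi 2^-1 -> {for 2^-1, continuous phi} ->
  exists n, Rintegral mu D (fun t => phi t * (t * (1 - t)) ^+ n) != 0.
Proof.
move=> iphi p0 cphi; apply: contrapT => /forallNP H0.
have H n : Rintegral mu D (fun t => phi t * (t * (1 - t)) ^+ n) = 0.
  by have /negP := H0 n; rewrite negbK => /eqP.
set eta := phi 2^-1 / 2.
have eta0 : 0 < eta by rewrite divr_gt0.
have [d [d0 d2 hd]] : exists d : R, [/\ 0 < d, d < 2^-1 &
    forall t, `|t - 2^-1| < d -> eta <= phi t].
  move/cvgrPdist_le : cphi => /(_ eta eta0)[e /= e0 he].
  exists (Num.min e 4^-1); split.
  - by rewrite lt_min e0 invr_gt0 ltr0n.
  - by rewrite gt_min; apply/orP; right; rewrite ltf_pV2 ?posrE ?ltr0n// ltr_nat.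
  - move=> t; rewrite lt_min => /andP[h _].
    have := he t; rewrite /ball_ /= distrC => /(_ h) h2.
    have := le_trans (ler_norm _) h2; rewrite /eta; lra.
(* As [t (1 - t) = 1/4 - (t - 1/2) ^ 2], the kernel is at least [A] within distance [d / 2] of 1/2,
   and at most [B < A] at distance [d] or more. *)
set A := 4^-1 - (d / 2) ^+ 2; set B := 4^-1 - d ^+ 2.
have d2' : d ^+ 2 < 4^-1.
  rewrite (_ : 4^-1 = 2^-1 ^+ 2 :> R); last by rewrite exprVn -natrX.
  by rewrite ltrXn2r// ?nnegrE ltW.
have dd : 0 < d ^+ 2 by rewrite exprn_gt0.
have B0 : 0 < B by rewrite subr_gt0.
have AB : B < A.
  rewrite /A /B ltrD2l ltrN2 expr_div_n ltr_pdivrMr ?exprn_gt0//.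
  by rewrite ltr_pMr// -natrX ltr1n.
have A0 : 0 < A by apply: lt_trans AB.
set I := `[2^-1 - d / 2, 2^-1 + d / 2]%classic.
have mI : measurable (I : set (measurableTypeR R)) by exact: measurable_itv.
have kE (t : R) : t * (1 - t) = 4^-1 - (t - 2^-1) ^+ 2 by field.
(* Within distance [d] of 1/2, [phi] is at least [eta]. Farther away its sign is unknown, but there
   the kernel is at most [B], so the term [B ^ n |phi|] compensates any negative value. *)
have pw n t : D t -> ((cst (eta * A ^+ n)) \_ I) t <=
    phi t * (t * (1 - t)) ^+ n + B ^+ n * `|phi t|.
  rewrite /= in_itv/= => /andP[t0 t1].
  have k0 : 0 <= t * (1 - t) by rewrite mulr_ge0 ?ltW// subr_gt0.
  have bp : 0 <= B ^+ n * `|phi t| by rewrite mulr_ge0// exprn_ge0// ltW.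
  have [hin|hout] := ltP `|t - 2^-1| d.
    have ep := hd t hin; have pp : 0 <= phi t by apply: le_trans ep; exact: ltW.
    rewrite patchE; case: ifPn => [/set_mem|_]; last first.
      by rewrite addr_ge0// mulr_ge0// exprn_ge0.
    rewrite /I /= in_itv/= => /andP[h1 h2].
    apply: (@le_trans _ _ (phi t * (t * (1 - t)) ^+ n)); last by rewrite lerDl.
    rewrite ler_pM ?exprn_ge0 ?(ltW A0) ?(ltW eta0)//.
    rewrite lerXn2r ?nnegrE ?(ltW A0)// kE lerD2l lerN2 -(real_normK (num_real (t - _))).
    rewrite lerXn2r ?nnegrE//; first by rewrite divr_ge0// ltW.
    rewrite ler_norml; apply/andP; split; lra.
  rewrite patchE ifF; last first.
    apply/negbTE/negP => /set_mem; rewrite /I /= in_itv/= => /andP[h1 h2].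
    have : `|t - 2^-1| <= d / 2 by rewrite ler_norml; apply/andP; split; lra.
    lra.
  rewrite addrC -lerBlDr sub0r.
  apply: (@le_trans _ _ (`|phi t| * (t * (1 - t)) ^+ n)).
    by rewrite -mulNr ler_wpM2r ?exprn_ge0// -normrN ler_norm.
  rewrite mulrC ler_wpM2r// lerXn2r ?nnegrE ?(ltW B0)//.
  rewrite kE lerD2l lerN2 -(real_normK (num_real (t - _))).
  by rewrite lerXn2r ?nnegrE// ltW.
set C := Rintegral mu D (fun t => `|phi t|).
(* [pw] is integrated: the integral of [phi] against the kernel is 0 by assumption, and [I] has
   length [d]. Dividing by [A ^ n] then bounds [eta * d] by a null sequence. *)
have key n : eta * A ^+ n * d <= B ^+ n * C.
  have mphi : measurable_fun D phi.
    by apply/measurable_EFinP; exact: measurable_int iphi.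
  have ik : mu.-integrable D (EFin \o (fun t => phi t * (t * (1 - t)) ^+ n)).
    apply: le_integrable iphi => //.
      apply/measurable_EFinP; apply: measurable_funM => //.
      apply: measurable_funX; apply: measurable_funM; first exact: measurable_id.
      by apply: measurable_funB; [exact: measurable_cst|exact: measurable_id].
    move=> t; rewrite /= in_itv/= => /andP[t0 t1]; rewrite lee_fin normrM ler_piMr//.
    have h : 0 <= t * (1 - t) by rewrite mulr_ge0 ?ltW// subr_gt0.
    by rewrite normrX exprn_ile1// ger0_norm// mulr_ile1 ?subr_ge0 ?ltW// gtrBl.
  have ia : mu.-integrable D (EFin \o (fun t => B ^+ n * `|phi t|)).
    exact: (integrableZl mD (B ^+ n) (integrable_norm iphi)).
  have ii : mu.-integrable D (EFin \o ((cst (eta * A ^+ n)) \_ I)).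
    rewrite -restrict_EFin; apply/(integrable_restrict mu mI mD).
    have hI : mu.-integrable I (EFin \o cst (eta * A ^+ n)).
      apply: continuous_compact_integrable; first exact: segment_compact.
      by apply: continuous_subspaceT => t; exact: cst_continuous.
    exact: (integrableS mI (measurableI _ _ mD mI) (@subIsetr _ D I) hI).
  have := le_Rintegral mD ii (integrableD mD ik ia) (pw n).
  rewrite RintegralD// H add0r RintegralZl//; last exact: integrable_norm.
  rewrite -Rintegral_mkcondr (_ : D `&` I = I); last first.
    apply/setIidr => t; rewrite /I /= !in_itv/= => /andP[h1 h2].
    apply/andP; split; lra.
  have muI : mu I = d%:E.
    rewrite /I lebesgue_measure_itv/= lte_fin ifT; last by lra.
    by rewrite -EFinB; congr EFin; lra.
  by rewrite Rintegral_cst// (_ : fine _ = d)//; exact: (congr1 fine muI).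
have C0 : 0 <= C by apply: Rintegral_ge0 => t _; exact: normr_ge0.
set r := B / A.
have r1 : `|r| < 1 by rewrite ger0_norm ?divr_ge0 ?ltW// ltr_pdivrMr// mul1r.
have key2 n : eta * d <= C * r ^+ n.
  have An : 0 < A ^+ n by rewrite exprn_gt0.
  rewrite -(ler_pM2r An) /r expr_div_n -(mulrA C) divfK ?gt_eqF//.
  by rewrite mulrAC [leRHS]mulrC.
have : (fun n => C * r ^+ n) @ \oo --> (0 : R).
  by rewrite -(mulr0 C); apply: cvgM; [exact: cvg_cst|exact: cvg_expr].
move/cvgrPdist_lt => /(_ (eta * d)); rewrite mulr_gt0// => /(_ isT)[n _ /(_ n (leqnn n))].
rewrite /= sub0r normrN ger0_norm; last by apply: le_trans (key2 n); rewrite mulr_ge0 ?ltW.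
by rewrite ltNge key2.
Qed.

Lemma cbeta_neq0 x y : 0 < complex.Re x -> 0 < complex.Re y -> cbeta x y != 0.
Proof.
move=> x0 y0; apply/negP => /eqP b0.
pose h t := cpow t (x - 1) * cpow (1 - t) (y - 1).
have h12 : 0 < (2^-1 : R) < 1 by rewrite invr_gt0 ltr0n invf_lt1// ltr1n.
(* Multiplying by this conjugate gives the integrand the value [|h (1/2)| ^ 2] at 1/2, so that its
   real part is positive there, as [concentration] requires. *)
pose c := conjc (h 2^-1).
pose phi t := complex.Re (c * h t).
have ih : cintegrable01 (fun t => c * h t) by exact: cintegrable01Z (cbeta_integrable x0 y0).
have [n] : exists n, Rintegral mu D (fun t => phi t * (t * (1 - t)) ^+ n) != 0.
  apply: concentration.
  - exact: ih.1.
  - rewrite /phi /c.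
    have : h 2^-1 != 0 by rewrite mulf_neq0 ?cpow_neq0.
    case: (h 2^-1) => a b; rewrite eq_complex /= => hab.
    rewrite mulNr opprK -!expr2 lt_neqAle addr_ge0 ?sqr_ge0// andbT eq_sym.
    by rewrite paddr_eq0 ?sqr_ge0// !sqrf_eq0.
  - have [h1 h2] := cpow_onem_continuous (x - 1) (y - 1) h12.
    rewrite /phi (_ : (fun t => _) = (fun t => complex.Re c * complex.Re (h t) - complex.Im c * complex.Im (h t))).
      by apply: cvgB; apply: cvgM => //; exact: cvg_cst.
    by apply/funext => t; rewrite cReM.
apply/negP; rewrite negbK; apply/eqP.
have := cbeta_eq0_shift n x0 y0 b0; rewrite /cbeta => h0.
have xn : 0 < complex.Re (x + n%:R) by rewrite cReD Re_nat ltr_wpDr.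
have yn : 0 < complex.Re (y + n%:R) by rewrite cReD Re_nat ltr_wpDr.
have hz := cint01Z c (cbeta_integrable xn yn); rewrite h0 mulr0 in hz.
transitivity (complex.Re (cint01 (fun t => c * (cpow t (x + n%:R - 1) *
    cpow (1 - t) (y + n%:R - 1))))); last by rewrite hz.
rewrite -[RHS]/(Rintegral mu D (fun t => complex.Re (c *
  (cpow t (x + n%:R - 1) * cpow (1 - t) (y + n%:R - 1))))).
apply: eq_Rintegral => t tD.
have /andP[t0 t1] : 0 < t < 1 by move: tD; rewrite inE/= in_itv.
have t1' : 0 < 1 - t by rewrite subr_gt0.
rewrite (addrAC x) (addrAC y) cpowDn// cpowDn// /phi exprMn /h.
set u := cpow _ _; set v := cpow _ _.
rewrite (_ : c * (u * (t ^+ n)%:C * (v * ((1 - t) ^+ n)%:C)) = (c * (u * v)) * (t ^+ n * (1 - t) ^+ n)%:C).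
  by rewrite cReM/= mulr0 subr0.
by rewrite rmorphM/=; ring.
Qed.

End cbeta_nonvanishing.

(** * A bound uniform in rho *)

Section parabola_substitution.
Variable R : realType.
Local Notation mu := (@lebesgue_measure R).
Local Notation D := (`]0, 1[%classic : set R).
Implicit Types (a b r t : R) (N : R -> R).


Lemma is_derive_parabola r t :
  is_derive t 1 (fun s => s * (1 - s) / r) ((1 - t *+ 2) / r).
Proof.
have h : is_derive t (1 : R) (fun s : R => s * (1 - s)) (t *: -1 + (1 - t) *: 1).
  by apply: is_deriveM; exact: is_derive_onem.
have -> : (fun s => s * (1 - s) / r) = r^-1 \*: (fun s => s * (1 - s)).
  by apply/funext => s; rewrite /= mulrC.
have -> : (1 - t *+ 2) / r = r^-1 *: (t *: -1 + (1 - t) *: 1).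
  by rewrite /GRing.scale/= mulrC; congr (_ * _); ring.
exact: is_deriveZ.
Qed.

Lemma continuous_kernel_comp N (t r : R) : continuous N -> 0 < t < 1 ->
  {for t, continuous (fun s : R => N (r / (s * (1 - s))))}.
Proof.
move=> cN /andP[t0 t1]; apply: (@continuous_comp _ _ _ (fun s : R => r / (s * (1 - s))) N); last exact: cN.
apply: cvgM; first exact: cvg_cst.
apply: cvgV; first by apply: mulf_neq0; rewrite gt_eqF ?subr_gt0.
apply: cvgM; first exact: cvg_id.
by apply: cvgB; [exact: cvg_cst|exact: cvg_id].
Qed.

Lemma bweight_continuous a b t : 0 < t < 1 -> {for t, continuous (bweight a b)}.
Proof.
move=> /andP[t0 t1]; apply: cvgM; first exact: continuous_powR.
have t1' : 0 < 1 - t by rewrite subr_gt0.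
exact: is_derive_continuous (is_derive_onem_powR (b - 1) t1').
Qed.

Lemma kernel_continuous N a b r t : continuous N -> 0 < t < 1 ->
  {for t, continuous (fun s : R => bweight a b s * N (r / (s * (1 - s))))}.
Proof.
by move=> cN t01; apply: cvgM; [exact: bweight_continuous|exact: continuous_kernel_comp].
Qed.

Lemma kernel_measurable N a b r : continuous N ->
  measurable_fun [set: R] (fun s => bweight a b s * N (r / (s * (1 - s)))).
Proof.
move=> cN; apply: measurable_funM; first exact: measurable_bweight.
apply: (measurableT_comp (continuous_measurable_fun cN)).
apply: measurable_funM; first exact: measurable_cst.
apply: (measurableT_comp (@measurable_invr R)).
apply: measurable_funM; first exact: measurable_id.
by apply: measurable_funB; [exact: measurable_cst|exact: measurable_id].
Qed.

(** Stopping at 1/4 stays on the increasing branch of the parabola and keeps [1 - 2 t >= 1/2], so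
    that the Jacobian can later be bounded from below. *)
Lemma parabola_subst (G : R -> R) r (e : R) : 0 < r -> 0 < e < 4^-1 ->
  (forall v : R, 0 < v -> {for v, continuous G}) ->
  (\int[mu]_(v in `[(e * (1 - e) / r)%R, (4^-1 * (1 - 4^-1) / r)%R]) (G v)%:E =
   \int[mu]_(t in `[e, 4^-1%R]) (G (t * (1 - t) / r) * ((1 - t *+ 2) / r))%:E)%E.
Proof.
move=> r0 /andP[e0 e4] cG.
have F'E : derive1 (fun s : R => s * (1 - s) / r) = (fun t : R => (1 - t *+ 2) / r).
  by apply/funext => t; rewrite derive1E; have h := is_derive_parabola r t; exact: derive_val.
have cF' : continuous (fun t : R => (1 - t *+ 2) / r).
  move=> t; apply: cvgM; last exact: cvg_cst.
  apply: cvgB; first exact: cvg_cst.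
  by rewrite mulr2n; under eq_fun do rewrite mulr2n; apply: cvgD; exact: cvg_id.
have cF t : {for t, continuous (fun s : R => s * (1 - s) / r)}.
  exact: is_derive_continuous (is_derive_parabola r t).
have := @integration_by_substitution_increasing R (fun s => s * (1 - s) / r) G e 4^-1.
rewrite F'E => -> //.
- exact: ltW.
- move=> s t; rewrite !in_itv/= => /andP[s1 s2] /andP[t1 t2] st.
  rewrite ltr_pM2r ?invr_gt0// -subr_gt0.
  have -> : t * (1 - t) - s * (1 - s) = (t - s) * (1 - t - s) by ring.
  rewrite mulr_gt0 ?subr_gt0//; lra.
- by apply/cvg_ex; eexists; apply: cvg_at_right_filter; exact: cF'.
- by apply/cvg_ex; eexists; apply: cvg_at_left_filter; exact: cF'.
- split.
  + by move=> t _; have [] := is_derive_parabola r t.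
  + by apply: cvg_at_right_filter; exact: cF.
  + by apply: cvg_at_left_filter; exact: cF.
- apply: continuous_in_subspaceT => v; rewrite inE/= in_itv/= => /andP[v1 _].
  apply: cG; apply: lt_le_trans v1; rewrite divr_gt0// mulr_gt0//; lra.
Qed.

(** The power of [t (1 - t)] yields the symmetric weight with exponent [a] at both ends. On the left
    part, exchanging the second exponent for [b] costs only a constant, because [1 - t] stays above
    1/2. *)
Lemma parabola_weightE a r t : 0 < r -> 0 < t < 1 ->
  (t * (1 - t) / r) `^ (a - 1) * ((1 - t *+ 2) / r) =
  r `^ (- a) * (bweight a a t * (1 - t *+ 2)).
Proof.
move=> r0 /andP[t0 t1].
rewrite powRM ?mulr_ge0 ?subr_ge0 ?invr_ge0 ?ltW// powRM ?subr_ge0 ?ltW//.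
have -> : r `^ (- a) = r^-1 `^ (a - 1) * r^-1.
  rewrite -powR_inv1 ?ltW// -powRrM -powRD; last by rewrite (gt_eqF r0) implybT.
  by congr (_ `^ _); ring.
rewrite /bweight; ring.
Qed.

Lemma onem_powR_split b c t : t < 1 ->
  (1 - t) `^ (b - 1) = (1 - t) `^ (b - c) * (1 - t) `^ (c - 1).
Proof.
move=> t1; rewrite -powRD; last by rewrite subr_eq0 (gt_eqF t1) implybT.
by congr (_ `^ _); ring.
Qed.

(** The factor 2 compensates [1 - 2 t >= 1/2]; the other constant bounds [(1 - t) ^ (b - a)]. *)
Lemma bweight_le_parabola a b r t : 0 < r -> 0 < t <= 4^-1 ->
  bweight a b t <= (2 * (1 + 2^-1 `^ (b - a))) * r `^ a *
     ((t * (1 - t) / r) `^ (a - 1) * ((1 - t *+ 2) / r)).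
Proof.
move=> r0 /andP[t0 t4].
have t1 : t < 1 by lra.
rewrite parabola_weightE ?t0//.
have -> : (2 * (1 + 2^-1 `^ (b - a))) * r `^ a * (r `^ (- a) * (bweight a a t * (1 - t *+ 2))) =
  (1 + 2^-1 `^ (b - a)) * (r `^ a * r `^ (- a)) * bweight a a t * (2 * (1 - t *+ 2)) by ring.
rewrite powRN mulfV ?gt_eqF ?powR_gt0// mulr1.
apply: (@le_trans _ _ ((1 + 2^-1 `^ (b - a)) * bweight a a t)).
  rewrite /bweight (onem_powR_split b a t1) mulrCA.
  by rewrite ler_wpM2r ?mulr_ge0 ?powR_ge0// powR_half_le//; lra.
rewrite ler_peMr ?mulr_ge0 ?bweight_ge0 ?addr_ge0 ?powR_ge0//.
by rewrite mulr2n; lra.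
Qed.

Lemma parabola_le_bweight a b r t : 0 < r -> 0 < t <= 4^-1 ->
  (t * (1 - t) / r) `^ (a - 1) * ((1 - t *+ 2) / r) <=
  (1 + 2^-1 `^ (a - b)) * r `^ (- a) * bweight a b t.
Proof.
move=> r0 /andP[t0 t4].
have t1 : t < 1 by lra.
rewrite parabola_weightE ?t0// [X in _ <= X * _]mulrC -[leRHS]mulrA ler_wpM2l ?powR_ge0//.
apply: (@le_trans _ _ (bweight a a t)).
  by rewrite ler_piMr ?bweight_ge0// mulr2n; lra.
rewrite /bweight (onem_powR_split a b t1) [leRHS]mulrCA.
rewrite ler_wpM2l ?powR_ge0// ler_wpM2r ?powR_ge0// powR_half_le//; lra.
Qed.

(* Substituting [v = t (1 - t) / r] makes the integrand independent of [r] up to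
   the factor [r ^ a]; only the range of integration still depends on [r]. *)
Lemma kernel_left_le N a b (r e : R) : continuous N -> (forall s, 0 <= N s) ->
  (forall s, 0 <= s <= 6 -> N s = 0) -> 0 < a -> 0 < r < 1 -> 0 < e < 4^-1 ->
  exists2 e' : R, 0 < e' < 4^-1 &
  (\int[mu]_(t in `[e, 4^-1%R]) (bweight a b t * N (r / (t * (1 - t))))%:E <=
   ((2 * (1 + 2^-1 `^ (b - a))) * ((1 + 2^-1 `^ (a - b)) * 2^-1 `^ (- a)))%:E *
   \int[mu]_(t in `[e', 4^-1%R]) (bweight a b t * N (2^-1 / (t * (1 - t))))%:E)%E.
Proof.
move=> cN N0 N6 a0 /andP[r0 r1] /andP[e0 e4].
(* The integrand in the variable [v = t (1 - t) / r]: it does not involve [r]. *)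
pose L v := v `^ (a - 1) * N v^-1.
have cL v : 0 < v -> {for v, continuous L}.
  move=> v0; apply: cvgM; first exact: continuous_powR.
  apply: (@continuous_comp _ _ _ (@GRing.inv R) N); last exact: cN.
  by apply: inv_continuous; rewrite gt_eqF.
have L0 v : 0 <= L v by rewrite mulr_ge0 ?powR_ge0.
have LE (s t : R) : 0 < t <= 4^-1 -> 0 < s ->
   L (t * (1 - t) / s) * ((1 - t *+ 2) / s) =
   (t * (1 - t) / s) `^ (a - 1) * ((1 - t *+ 2) / s) * N (s / (t * (1 - t))).
  by move=> _ s0; rewrite /L invf_div mulrAC.
have mL : measurable_fun [set: R] L.
  apply: measurable_funM; first exact: measurable_powR.
  exact: measurableT_comp (continuous_measurable_fun cN) (@measurable_invr R).
have mLF s : measurable_fun [set: R] (fun t => L (t * (1 - t) / s) * ((1 - t *+ 2) / s)).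
  have mid : measurable_fun [set: R] (id : R -> R) by exact: measurable_id.
  have mo : measurable_fun [set: R] (fun t : R => 1 - t).
    by apply: measurable_funB => //; exact: measurable_cst.
  apply: measurable_funM.
    apply: (measurableT_comp mL); apply: measurable_funM; last exact: measurable_cst.
    exact: measurable_funM.
  apply: measurable_funM; last exact: measurable_cst.
  apply: measurable_funB; first exact: measurable_cst.
  exact: measurable_funD.
have LF0 (s t : R) : 0 < t <= 4^-1 -> 0 < s ->
    0 <= L (t * (1 - t) / s) * ((1 - t *+ 2) / s).
  move=> /andP[t0 t4] s0; rewrite mulr_ge0 ?divr_ge0 ?(ltW s0)//.
  by rewrite mulr2n; lra.
(* Chosen so that [2 e' (1 - e') <= e (1 - e) <= e (1 - e) / r]: the lower end of the [v]-range for
   parameter 1/2 then lies below the one for [r], whatever [r < 1] is. *)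
exists (e * (1 - e) / 2).
  apply/andP; split; first by rewrite divr_gt0// mulr_gt0// subr_gt0; lra.
  rewrite ltr_pdivrMr//; apply: (@lt_trans _ _ e); last by lra.
  by rewrite gtr_pMr//; lra.
set e' := e * (1 - e) / 2.
have e'0 : 0 < e' by rewrite divr_gt0// mulr_gt0// subr_gt0; lra.
have e'e : e' < e.
  by rewrite /e' ltr_pdivrMr// ltr_pM2l//; lra.
set K1 := 2 * _; set K2 := 1 + 2^-1 `^ (a - b).
have K10 : 0 <= K1 by rewrite mulr_ge0// addr_ge0 ?powR_ge0.
have K20 : 0 <= K2 by rewrite addr_ge0 ?powR_ge0.
have mk s (A : set R) : measurable (A : set (measurableTypeR R)) ->
   measurable_fun A (fun t => bweight a b t * N (s / (t * (1 - t)))).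
  by move=> mA; have h := kernel_measurable a b s cN; exact: measurable_funS h.
have mI (x y : R) : measurable (`[x, y]%classic : set (measurableTypeR R)).
  exact: measurable_itv.
have mLE : measurable_fun [set: R] (fun v => (L v)%:E) by exact/measurable_EFinP.
have step1 : (\int[mu]_(t in `[e, 4^-1%R]) (bweight a b t * N (r / (t * (1 - t))))%:E <=
   K1%:E * \int[mu]_(v in `[(e * (1 - e) / r)%R, (4^-1 * (1 - 4^-1) / r)%R]) (L v)%:E)%E.
  rewrite (parabola_subst r0 _ cL) ?e0//.
  rewrite -ge0_integralZl_EFin//; last 2 first.
  - move=> t; rewrite /= in_itv/= => /andP[t1 t2]; rewrite lee_fin LF0//.
    by rewrite t2 (lt_le_trans e0).
  - by apply/measurable_EFinP; exact: measurable_funS (mLF r).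
  apply: ge0_le_integral => //.
  - by move=> t _; rewrite lee_fin mulr_ge0 ?bweight_ge0.
  - by apply/measurable_EFinP; exact: mk.
  - by apply/measurable_EFinP; apply: measurable_funM; [exact: measurable_cst|exact: measurable_funS (mLF r)].
  - move=> t; rewrite /= in_itv/= => /andP[t1 t2].
    have t04 : 0 < t <= 4^-1 by rewrite t2 (lt_le_trans e0).
    rewrite -EFinM lee_fin LE// mulrA ler_wpM2r//.
    apply: le_trans (bweight_le_parabola a b r0 t04) _.
    rewrite ler_wpM2r//.
      case/andP: t04 => t0 _; rewrite mulr_ge0 ?powR_ge0// divr_ge0 ?(ltW r0)//.
      by rewrite mulr2n; lra.
    (* Here [r ^ a <= 1] removes the last dependence of the constant on [r]. *)
    rewrite ler_piMr// [leRHS](_ : 1 = 1 `^ a); last by rewrite powR1.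
    by rewrite ge0_ler_powR ?nnegrE ?(ltW a0) ?(ltW r0) ?(ltW r1).
have step2 : (\int[mu]_(v in `[(e * (1 - e) / r)%R, (4^-1 * (1 - 4^-1) / r)%R]) (L v)%:E <=
  \int[mu]_(v in `[(e' * (1 - e') / 2^-1)%R, (4^-1 * (1 - 4^-1) / 2^-1)%R]) (L v)%:E)%E.
  rewrite integral_mkcond [leRHS]integral_mkcond.
  apply: ge0_le_integral => //.
  - by move=> v _; rewrite patchE; case: ifP => // _; rewrite lee_fin.
  - apply/(measurable_restrictT _ (mI _ _)).
    by apply: measurable_funS mLE.
  - apply/(measurable_restrictT _ (mI _ _)).
    by apply: measurable_funS mLE.
  move=> v _; rewrite !patchE; case: ifPn => [/set_mem|_]; last first.
    by case: ifP => // _; rewrite lee_fin.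
  rewrite /= in_itv/= => /andP[v1 v2].
  have h1 : e' * (1 - e') / 2^-1 <= v.
    apply: le_trans v1; rewrite invrK ler_pdivlMr//.
    have -> : e' * (1 - e') * 2 * r = (e * (1 - e)) * ((1 - e') * r).
      by rewrite /e'; field.
    rewrite ler_piMr ?mulr_ge0 ?mulr_ile1 ?subr_ge0 ?(ltW r0) ?(ltW r1) ?(ltW e0)//; lra.
  have [h2|h2] := leP v (4^-1 * (1 - 4^-1) / 2^-1).
    by rewrite ifT// inE /= in_itv/= h1 h2.
  (* For [r < 1/2] the range extends past 3/8, the upper end for parameter 1/2. There [1 / v < 8/3],
     inside the interval where [N] vanishes. *)
  have -> : L v = 0.
    rewrite /L N6 ?mulr0// invr_ge0.
    have v6 : 6^-1 <= v by move: h2; rewrite invrK; lra.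
    have v0 : 0 < v by apply: lt_le_trans v6; rewrite invr_gt0.
    by rewrite (ltW v0)/= -[leRHS]invrK lef_pV2 ?posrE ?invr_gt0.
  by case: ifP.
have step3 : (\int[mu]_(v in `[(e' * (1 - e') / 2^-1)%R, (4^-1 * (1 - 4^-1) / 2^-1)%R]) (L v)%:E
  <= (K2 * 2^-1 `^ (- a))%:E *
   \int[mu]_(t in `[e', 4^-1%R]) (bweight a b t * N (2^-1 / (t * (1 - t))))%:E)%E.
  have h2 : 0 < 2^-1 :> R by rewrite invr_gt0.
  rewrite (parabola_subst h2 _ cL); last by rewrite e'0 (lt_trans e'e).
  have K0 : 0 <= K2 * 2^-1 `^ (- a) by rewrite mulr_ge0 ?powR_ge0.
  rewrite -ge0_integralZl_EFin//; last 2 first.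
  - by move=> t _; rewrite lee_fin mulr_ge0 ?bweight_ge0.
  - by apply/measurable_EFinP; exact: mk.
  apply: ge0_le_integral => //.
  - move=> t; rewrite /= in_itv/= => /andP[t1 t2]; rewrite lee_fin LF0//.
    by rewrite t2 (lt_le_trans e'0).
  - by apply/measurable_EFinP; exact: measurable_funS (mLF _).
  - by apply/measurable_EFinP; apply: measurable_funM; [exact: measurable_cst|exact: mk].
  - move=> t; rewrite /= in_itv/= => /andP[t1 t2].
    have t04 : 0 < t <= 4^-1 by rewrite t2 (lt_le_trans e'0).
    rewrite -EFinM lee_fin LE// [leRHS]mulrA ler_wpM2r//.
    exact: parabola_le_bweight.
apply: (le_trans step1); rewrite [(K1 * _)%:E]EFinM -muleA lee_wpmul2l ?lee_fin//.
exact: le_trans step2 step3.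
Qed.

End parabola_substitution.

Section uniform_bound_in_rho.
Variable R : realType.
Local Notation mu := (@lebesgue_measure R).
Local Notation D := (`]0, 1[%classic : set R).
Implicit Types (a b r t : R) (N : R -> R).


Lemma kernel_reflect N a b r (e : R) : continuous N -> 0 < e < 4^-1 ->
  (\int[mu]_(t in `[(1 - 4^-1)%R, (1 - e)%R]) (bweight a b t * N (r / (t * (1 - t))))%:E =
   \int[mu]_(t in `[e, 4^-1%R]) (bweight b a t * N (r / (t * (1 - t))))%:E)%E.
Proof.
move=> cN /andP[e0 e4].
pose F := fun t : R => 1 - t.
have F'E : derive1 F = (fun=> -1).
  by apply/funext => t; rewrite derive1E; have h := is_derive_onem t; exact: derive_val.
have cF t : {for t, continuous F} by exact: is_derive_continuous (is_derive_onem t).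
pose G t := bweight b a t * N (r / (t * (1 - t))).
have := @integration_by_substitution_decreasing R F G (1 - 4^-1) (1 - e).
rewrite F'E.
have -> : F (1 - e) = e by rewrite /F; ring.
have -> : F (1 - 4^-1) = 4^-1 by rewrite /F; ring.
rewrite -/(G _) => -> //.
- apply: eq_integral => t _; congr EFin.
  rewrite /= /G /F /bweight !fctE opprK mulr1.
  have -> : 1 - (1 - t) = t by ring.
  by rewrite [(1 - t) * t]mulrC [_ `^ _ * _ `^ _]mulrC.
- by rewrite lerD2l lerN2 ltW.
- by move=> s t _ _ st; rewrite /F ltrD2l ltrN2.
- by move=> t _; exact: cvg_cst.
- exact: is_cvg_cst.
- exact: is_cvg_cst.
- split.
  + by move=> t _; have [] := is_derive_onem t.
  + by apply: cvg_at_right_filter; exact: cF.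
  + by apply: cvg_at_left_filter; exact: cF.
- apply: continuous_in_subspaceT => t; rewrite inE/= in_itv/= => /andP[t1 t2].
  by apply: kernel_continuous => //; lra.
Qed.

Lemma continuous_bounded_segment N (S : R) : 0 <= S -> continuous N ->
  exists2 M : R, 0 <= M & forall s, 0 <= s <= S -> N s <= M.
Proof.
move=> S0 cN.
have [|c _ hc] := @EVT_max R N 0 S S0; first by apply: continuous_subspaceT.
exists (Num.max (N c) 0); first by rewrite le_max lexx orbT.
move=> s hs; rewrite le_max; apply/orP; left; apply: hc.
by rewrite in_itv.
Qed.

(* Only the part of [N] beyond its maximum on [[0, 6]] can contribute an
   unbounded amount; it lives near the endpoints, where [kernel_left_le] applies. *)
Lemma kernel_bounded N a b : continuous N -> (forall s, 0 <= N s) ->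
  0 < a -> 0 < b ->
  mu.-integrable D (fun t => (bweight a b t * N (2^-1 / (t * (1 - t))))%:E) ->
  exists C : R, forall r, 0 < r < 1 ->
    (\int[mu]_(t in D) (bweight a b t * N (r / (t * (1 - t))))%:E <= C%:E)%E.
Proof.
move=> cN N0 a0 b0 iN.
(* The number 6 exceeds 16/3, a bound of [r / (t (1 - t))] for [t] between 1/4 and 3/4, and also the
   8/3 met in [kernel_left_le]. *)
have [M M0 hM] := @continuous_bounded_segment N 6 (ler0n _ _) cN.
(* The positive part is still continuous, which a truncation of [N] need not be, and continuity is
   what the substitution asks for. *)
pose P s := Num.max (N s - M) 0.
have cP : continuous P.
  move=> s; apply: (continuous_max (f := fun s => N s - M : R^o) (g := fun=> 0)).
    by apply: cvgB; [exact: cN|exact: cvg_cst].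
  exact: cvg_cst.
have P0 s : 0 <= P s by rewrite le_max lexx orbT.
have P6 s : 0 <= s <= 6 -> P s = 0.
  by move=> /hM h; rewrite /P; apply/max_idPr; rewrite subr_le0.
have PN s : P s <= N s by rewrite /P ge_max N0 andbT gerBl.
have NP s : N s <= M + P s by rewrite -lerBlDl le_max lexx.
set k := fun (u v r t : R) => bweight u v t * P (r / (t * (1 - t))).
have k0 u v r t : 0 <= k u v r t by rewrite mulr_ge0 ?bweight_ge0.
have mk u v r (A : set R) : measurable (A : set (measurableTypeR R)) ->
    measurable_fun A (fun t => (k u v r t)%:E).
  by move=> mA; apply/measurable_EFinP; have h := kernel_measurable u v r cP; exact: measurable_funS h.
set I := (\int[mu]_(t in D) (k a b 2^-1 t)%:E)%E.
have I_fin : (I < +oo)%E.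
  move/integrableP : iN => [mN]; apply: le_lt_trans.
  apply: ge0_le_integral => //.
  - by move=> t _; rewrite lee_fin.
  - exact: mk.
  - exact: measurableT_comp mN.
  - move=> t _; rewrite lee_fin; apply: le_trans (ler_norm _).
    by rewrite ler_wpM2l ?bweight_ge0.
have I0 : (0 <= I)%E by apply: integral_ge0 => s _; rewrite lee_fin.
have If : I \is a fin_num by rewrite (ge0_fin_numE I0).
have IE : I = (fine I)%:E by rewrite fineK.
have mI (x y : R) : measurable (`[x, y]%classic : set (measurableTypeR R)).
  exact: measurable_itv.
have sub_le (x y : R) : 0 < x -> y < 1 -> (\int[mu]_(t in `[x, y]) (k a b 2^-1 t)%:E <= I)%E.
  move=> x0 y1; apply: ge0_subset_integral => //; first exact: mk.
  - by move=> t _; rewrite lee_fin.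
  - move=> t; rewrite /= !in_itv/= => /andP[h1 h2].
    by rewrite (lt_le_trans x0 h1) (le_lt_trans h2 y1).
pose K u v : R := (2 * (1 + 2^-1 `^ (v - u))) * ((1 + 2^-1 `^ (u - v)) * 2^-1 `^ (- u)).
have K0 u v : 0 <= K u v by rewrite !mulr_ge0 ?addr_ge0 ?powR_ge0.
have left_le r e : 0 < r < 1 -> 0 < e < 4^-1 ->
    (\int[mu]_(t in `[e, 4^-1%R]) (k a b r t)%:E <= (K a b)%:E * I)%E.
  move=> r01 e04; have [e' /andP[e'0 e'4] h] := kernel_left_le b cP P0 P6 a0 r01 e04.
  apply: (le_trans h); rewrite lee_wpmul2l ?lee_fin ?K0//.
  by apply: sub_le => //; lra.
have right_le r e : 0 < r < 1 -> 0 < e < 4^-1 ->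
    (\int[mu]_(t in `[(1 - 4^-1)%R, (1 - e)%R]) (k a b r t)%:E <= (K b a)%:E * I)%E.
  move=> r01 e04; rewrite kernel_reflect//.
  have [e' /andP[e'0 e'4] h] := kernel_left_le a cP P0 P6 b0 r01 e04.
  apply: (le_trans h); rewrite lee_wpmul2l ?lee_fin ?K0//.
  (* Reflected back, the reference integral is again one for the weight with exponents [a] and [b],
     hence at most [I]. *)
  rewrite -kernel_reflect ?e'0//.
  by apply: sub_le; lra.
have bw_int := bweight_integrable a0 b0.
set B := (\int[mu]_(t in D) (bweight a b t)%:E)%E.
have Bf : B \is a fin_num by exact: integrable_fin_num bw_int.
have BE : B = (fine B)%:E by rewrite fineK.
exists (M * fine B + (K a b * fine I + K b a * fine I)) => r r01.
have hP : (\int[mu]_(t in D) (k a b r t)%:E <= (K a b * fine I + K b a * fine I)%:E)%E.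
  (* Halved in order to lie below 1/4, as [left_le] and [right_le] require. *)
  pose e n : R := n.+3%:R^-1 / 2.
  have e0 n : 0 < e n by rewrite divr_gt0 // invr_gt0 ltr0n.
  have e4 n : e n < 4^-1.
    rewrite /e (_ : 4^-1 = 2^-1 / 2 :> R); last by field.
    by rewrite ltr_pM2r ?invr_gt0//; exact: invn_lt_half.
  apply: (@ge0_integral_exhaustion_le R D (fun n => `[e n, 1 - e n]%classic)) => //.
  - by apply/measurable_EFinP; exact: mk.
  - move=> m n mn t; rewrite /= !in_itv/= => /andP[h1 h2].
    have h3 : e n <= e m by rewrite ler_pM2r ?invr_gt0//; exact: invn_le.
    by apply/andP; split; lra.
  - move=> t; rewrite /= in_itv/= => /andP[t0 t1].
    have [n1 hn1] := exists_invn_le t0.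
    have [|n2 hn2] := @exists_invn_le R (1 - t); first by rewrite subr_gt0.
    exists (maxn n1 n2); rewrite /= in_itv/=.
    have h1 := invn_le R (leq_maxl n1 n2); have h2 := invn_le R (leq_maxr n1 n2).
    have h3 : 0 < (maxn n1 n2).+3%:R^-1 :> R by rewrite invr_gt0 ltr0n.
    move: h1 h2 h3; rewrite /e; set x := (maxn n1 n2).+3%:R^-1 => h1 h2 h3.
    have h4 := le_trans h1 hn1; have h5 := le_trans h2 hn2.
    by clear -h3 h4 h5; apply/andP; split; lra.
  move=> n.
  set A1 := `[e n, 4^-1]%classic; set A2 := `[1 - 4^-1, 1 - e n]%classic.
  apply: (@le_trans _ _ (\int[mu]_(t in A1) (k a b r t)%:E + \int[mu]_(t in A2) (k a b r t)%:E)%E).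
    rewrite [leLHS]integral_mkcond [X in (_ <= X + _)%E]integral_mkcond.
    rewrite [X in (_ <= _ + X)%E]integral_mkcond.
    have mkA (A : set R) : measurable (A : set (measurableTypeR R)) ->
       measurable_fun [set: R] ((fun t => (k a b r t)%:E) \_ A).
      by move=> mA; apply/(measurable_restrictT _ mA); exact: mk.
    have kA0 (A : set R) t : (0 <= ((fun t => (k a b r t)%:E) \_ A) t)%E.
      by rewrite patchE; case: ifP => // _; rewrite lee_fin.
    rewrite -ge0_integralD//; try exact: (mkA _ (mI _ _)).
    apply: ge0_le_integral => //.
    - by apply: mkA; apply: measurableI => //; exact: mI.
    - by apply: emeasurable_funD; exact: (mkA _ (mI _ _)).
    move=> t _; rewrite [leLHS]patchE; case: ifPn => [/set_mem|_]; last first.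
      by rewrite adde_ge0.
    rewrite /= !in_itv/= => -[/andP[t0 t1] /andP[h1 h2]].
    have [h3|h3] := leP t 4^-1.
      rewrite [X in (_ <= X + _)%E]patchE ifT; last by rewrite inE /A1 /= in_itv/= h1 h3.
      by rewrite leeDl.
    have [h4|h4] := leP (1 - 4^-1) t.
      rewrite [X in (_ <= _ + X)%E]patchE ifT; last by rewrite inE /A2 /= in_itv/= h4 h2.
      by rewrite leeDr.
    (* Between 1/4 and 3/4 one has [t (1 - t) >= 3/16], so the argument of [P] is at most 16/3. *)
    suff -> : k a b r t = 0 by rewrite adde_ge0.
    rewrite /k P6 ?mulr0//.
    have tt : 0 < t * (1 - t) by rewrite mulr_gt0// subr_gt0.
    case/andP: r01 => r0 r1; rewrite divr_ge0 ?(ltW r0) ?(ltW tt)//=.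
    rewrite ler_pdivrMr//; apply: (@le_trans _ _ 1); first exact: ltW.
    have : 0 <= (t - 4^-1) * (1 - 4^-1 - t) by rewrite mulr_ge0; lra.
    have -> : (t - 4^-1) * (1 - 4^-1 - t) = t * (1 - t) - 3 / 16 by field.
    lra.
  rewrite EFinD !EFinM -IE; apply: leeD.
  - by apply: left_le => //; rewrite e0 e4.
  - by apply: right_le => //; rewrite e0 e4.
apply: (@le_trans _ _ (\int[mu]_(t in D) ((M * bweight a b t)%:E + (k a b r t)%:E))%E).
  apply: ge0_le_integral => //.
  - by move=> t _; rewrite lee_fin mulr_ge0 ?bweight_ge0.
  - by apply/measurable_EFinP; have h := kernel_measurable a b r cN; exact: measurable_funS h.
  - apply: emeasurable_funD; last exact: mk.
    apply/measurable_EFinP; apply: measurable_funM; first exact: measurable_cst.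
    by have h := @measurable_bweight R a b; exact: measurable_funS h.
  - move=> t _; rewrite -EFinD lee_fin /k mulrC -(mulrC (P _)) -mulrDl.
    by rewrite ler_wpM2r ?bweight_ge0.
rewrite ge0_integralD//; first last.
- exact: mk.
- by move=> t _; rewrite lee_fin.
- apply/measurable_EFinP; apply: measurable_funM; first exact: measurable_cst.
  by have h := @measurable_bweight R a b; exact: measurable_funS h.
- by move=> t _; rewrite lee_fin mulr_ge0 ?bweight_ge0.
rewrite EFinD leeD//.
under eq_integral do rewrite EFinM.
rewrite ge0_integralZl_EFin//.
- by rewrite EFinM -BE.
- by move=> t _; rewrite lee_fin bweight_ge0.
- apply/measurable_EFinP.
  by have h := @measurable_bweight R a b; exact: measurable_funS h.
Qed.

End uniform_bound_in_rho.

(** * Entire power series *)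

Section entire_series.
Variable R : realType.
Implicit Types (c : nat -> R) (x K : R).

(** Infinite radius of convergence, expressed by bounded terms: this form can be read off one
    convergent series at each scale and passes easily to other coefficients. Summability returns on
    enlarging [K]. *)
Definition entire_coef c :=
  forall K, 0 <= K -> exists M, forall m, `|c m| * K ^+ m <= M.

(** Boundedness at [2 K] gives a geometric majorant of ratio 1/2 at [K]. *)
Lemma entire_coef_summable c K : entire_coef c -> 0 <= K ->
  cvgn (series (fun m => `|c m| * K ^+ m)).
Proof.
move=> ec K0; have [M hM] := ec (2 * K) (mulr_ge0 (ler0n _ 2) K0).
apply: (@series_le_cvg _ _ (geometric M 2^-1)).
- by move=> n; rewrite mulr_ge0// exprn_ge0.
- move=> n; rewrite /geometric /= mulr_ge0 ?exprn_ge0 ?invr_ge0//.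
  by apply: le_trans (hM 0%N); rewrite mulr_ge0.
- move=> n; rewrite /geometric /= exprVn ler_pdivlMr ?exprn_gt0//.
  by rewrite -mulrA -exprMn [K * 2]mulrC.
- by apply: is_cvg_geometric_series; rewrite ger0_norm ?invr_ge0// invf_lt1// ltr1n.
Qed.

Lemma entire_coef_pseries c x : entire_coef c -> cvgn (pseries c x).
Proof.
move=> ec; apply: normed_cvg.
have := entire_coef_summable ec (normr_ge0 x); rewrite /pseries.
by under [X in cvgn (series X) -> _]eq_fun do rewrite -normrX -normrM.
Qed.

(** The new factor [m + 1] is absorbed by [2 ^ (m + 1)], and [K ^ m <= (K + 1) ^ (m + 1)] adjusts
    the exponent even for [K < 1]. *)
Lemma entire_coef_diffs c : entire_coef c -> entire_coef (pseries_diffs c).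
Proof.
move=> ec K K0; have K1 : 0 <= K + 1 by rewrite addr_ge0.
have [M hM] := ec (2 * (K + 1)) (mulr_ge0 (ler0n _ 2) K1).
exists M => m; apply: le_trans (hM m.+1).
rewrite /pseries_diffs normrM mulrAC mulrC ler_wpM2l//.
rewrite exprMn ger0_norm//; apply: ler_pM => //; first exact: exprn_ge0.
  by rewrite -natrX ler_nat ltnW// ltn_expl.
apply: (@le_trans _ _ ((K + 1) ^+ m)).
  by rewrite lerXn2r ?nnegrE// lerDl.
by rewrite exprS ler_peMl ?exprn_ge0// lerDr.
Qed.

Lemma entire_coef_continuous c : entire_coef c ->
  continuous (fun x => limn (pseries c x)).
Proof.
move=> ec x; have ed := entire_coef_diffs ec; have edd := entire_coef_diffs ed.
apply: (@is_derive_continuous R _ x (limn (pseries (pseries_diffs c) x))).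
apply: (@pseries_snd_diffs R c (`|x| + 1)); try exact: entire_coef_pseries.
by rewrite [ltRHS]ger0_norm ?addr_ge0// ltrDl.
Qed.

(** The terms of a convergent series are bounded, and [S] may be taken beyond any given [K]; no
    absolute convergence is assumed. *)
Lemma entire_coef_of_csummable (a : nat -> R[i]) :
  (forall s : R, 0 < s -> exists2 S : R, s <= S &
     csummable (fun m => a m * (- S%:C) ^+ m)) ->
  entire_coef (@normc R \o a).
Proof.
move=> h K K0; have [S KS /csummable_bounded[M hM]] := h (K + 1) (ltr_wpDl K0 ltr01).
exists M => m; apply: le_trans (hM m).
rewrite normcM normcX normcN normcR /= ger0_norm ?normc_ge0//.
have KS' : K <= `|S|.
  by apply: le_trans (ler_norm _); apply: le_trans KS; rewrite lerDl.
by rewrite ler_wpM2l ?normc_ge0// lerXn2r ?nnegrE.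
Qed.

Definition entire_fun (a : nat -> R[i]) (s : R) : R[i] :=
  csum (fun m => a m * (- s%:C) ^+ m).

Lemma entire_fun_summable (a : nat -> R[i]) (s : R) :
  entire_coef (@normc R \o a) -> csummable (fun m => a m * (- s%:C) ^+ m).
Proof.
move=> ea; apply: csummable_norm.
have := entire_coef_summable ea (normr_ge0 s).
rewrite (_ : (fun m => _) = (@normc R \o (fun m => a m * (- s%:C) ^+ m)))//.
apply/funext => m /=.
by rewrite normcM normcX normcN normcR ger0_norm ?normc_ge0.
Qed.

Lemma entire_fun_ReIm (a : nat -> R[i]) (s : R) : entire_coef (@normc R \o a) ->
  complex.Re (entire_fun a s) = limn (pseries (fun m => complex.Re (a m)) (- s)) /\
  complex.Im (entire_fun a s) = limn (pseries (fun m => complex.Im (a m)) (- s)).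
Proof.
move=> ea; have /csummable_to/csum_toP[h1 h2] := @entire_fun_summable a s ea.
have e m : (- s%:C) ^+ m = ((- s) ^+ m)%:C :> R[i] by rewrite rmorphXn rmorphN.
split; apply/esym/cvg_lim => //; rewrite /pseries.
- move: h1; rewrite (_ : @complex.Re R \o _ = (fun m => complex.Re (a m) * (- s) ^+ m))//.
  by apply/funext => m /=; rewrite e cReM /= mulr0 subr0.
- move: h2; rewrite (_ : @complex.Im R \o _ = (fun m => complex.Im (a m) * (- s) ^+ m))//.
  by apply/funext => m /=; rewrite e cImM /= mulr0 add0r.
Qed.

Lemma entire_fun_continuous (a : nat -> R[i]) : entire_coef (@normc R \o a) ->
  continuous (fun s => complex.Re (entire_fun a s)) /\
  continuous (fun s => complex.Im (entire_fun a s)).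
Proof.
move=> ea.
have eR : entire_coef (fun m => complex.Re (a m)).
  move=> K K0; have [M hM] := ea K K0; exists M => m; apply: le_trans (hM m).
  by rewrite ler_wpM2r ?exprn_ge0//= [leRHS]ger0_norm ?normc_ge0// normr_Re_le.
have eI : entire_coef (fun m => complex.Im (a m)).
  move=> K K0; have [M hM] := ea K K0; exists M => m; apply: le_trans (hM m).
  by rewrite ler_wpM2r ?exprn_ge0//= [leRHS]ger0_norm ?normc_ge0// normr_Im_le.
split.
- rewrite (_ : (fun s => _) = (fun x => limn (pseries (fun m => complex.Re (a m)) x)) \o -%R).
    by move=> s; apply: continuous_comp; [exact: opp_continuous|exact: entire_coef_continuous].
  by apply/funext => s; case: (entire_fun_ReIm s ea).
- rewrite (_ : (fun s => _) = (fun x => limn (pseries (fun m => complex.Im (a m)) x)) \o -%R).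
    by move=> s; apply: continuous_comp; [exact: opp_continuous|exact: entire_coef_continuous].
  by apply/funext => s; case: (entire_fun_ReIm s ea).
Qed.

Lemma entire_fun_normc_continuous (a : nat -> R[i]) : entire_coef (@normc R \o a) ->
  continuous (fun s => normc (entire_fun a s) : R).
Proof.
move=> /entire_fun_continuous[h1 h2] s.
have e (z : R[i]) : normc z = Num.sqrt (complex.Re z * complex.Re z + complex.Im z * complex.Im z).
  by case: z => x y; rewrite -!expr2.
rewrite (_ : (fun s => _) = (fun s => Num.sqrt (complex.Re (entire_fun a s) * complex.Re (entire_fun a s) + complex.Im (entire_fun a s) * complex.Im (entire_fun a s)))).
  apply: (@continuous_comp _ _ _ (fun s => complex.Re (entire_fun a s) * complex.Re (entire_fun a s) + complex.Im (entire_fun a s) * complex.Im (entire_fun a s)) (@Num.sqrt R)); last exact: sqrt_continuous.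
  by apply: cvgD; apply: cvgM; by [exact: h1|exact: h2].
by apply/funext => u; rewrite e.
Qed.

Lemma entire_fun_cmeas (a : nat -> R[i]) : entire_coef (@normc R \o a) ->
  cmeas [set: R] (entire_fun a).
Proof.
move=> /entire_fun_continuous[h1 h2].
by split; exact: continuous_measurable_fun.
Qed.

End entire_series.

(** * The beta transform *)

Section fubini01.
Variable R : realType.
Local Notation mu := (@lebesgue_measure R).
Local Notation D := (`]0, 1[%classic : set R).

Let mD : measurable (D : set (measurableTypeR R)).
Proof. exact: measurable_itv. Qed.

(** Every section is assumed integrable, not just almost every one, so that the real-valued inner
    integrals agree with the extended ones at each point and no exceptional null set appears. *)
Lemma Rintegral_fubini01 (h : R * R -> R) : measurable_fun [set: R * R] h ->
  (forall x, D x -> mu.-integrable D (fun y => (h (x, y))%:E)) ->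
  (forall y, D y -> mu.-integrable D (fun x => (h (x, y))%:E)) ->
  (\int[mu]_(x in D) \int[mu]_(y in D) `|h (x, y)|%:E < +oo)%E ->
  [/\ mu.-integrable D (fun x => (Rintegral mu D (fun y => h (x, y)))%:E),
      mu.-integrable D (fun y => (Rintegral mu D (fun x => h (x, y)))%:E) &
    Rintegral mu D (fun x => Rintegral mu D (fun y => h (x, y))) =
    Rintegral mu D (fun y => Rintegral mu D (fun x => h (x, y)))].
Proof.
move=> mh hx hy hfin.
(* Extension by zero to the whole plane, on which Fubini's theorem is applied. *)
pose g : R * R -> \bar R := (EFin \o h) \_ (D `*` D).
have mDD : measurable (D `*` D : set (measurableTypeR R * measurableTypeR R)).
  exact: measurableX.
have mg : measurable_fun [set: measurableTypeR R * measurableTypeR R] g.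
  apply/(measurable_restrictT _ mDD).
  by apply/measurable_EFinP; exact: measurable_funS mh.
have gx x y : D x -> g (x, y) = ((EFin \o (fun y => h (x, y))) \_ D) y.
  move=> Dx; rewrite /g !patchE; congr (if _ then _ else _).
  by apply/idP/idP => /set_mem H; apply/mem_set; [exact: H.2|split].
have gy x y : D y -> g (x, y) = ((EFin \o (fun x => h (x, y))) \_ D) x.
  move=> Dy; rewrite /g !patchE; congr (if _ then _ else _).
  by apply/idP/idP => /set_mem H; apply/mem_set; [exact: H.1|split].
have gx0 x y : ~ D x -> g (x, y) = 0%E.
  by move=> Dx; rewrite /g patchE ifF//; apply/negbTE/negP => /set_mem[].
have gy0 x y : ~ D y -> g (x, y) = 0%E.
  by move=> Dy; rewrite /g patchE ifF//; apply/negbTE/negP => /set_mem[].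
have Fx : fubini_F mu g = (fun x => (Rintegral mu D (fun y => h (x, y)))%:E) \_ D.
  apply/funext => x; rewrite /fubini_F patchE; case: ifPn => [/set_mem Dx|nDx].
    transitivity (\int[mu]_y ((EFin \o (fun y => h (x, y))) \_ D) y)%E.
      by apply: eq_integral => y _; rewrite gx.
    by rewrite -integral_mkcond /Rintegral fineK//; exact: integrable_fin_num (hx x Dx).
  apply: integral0_eq => y _; rewrite gx0// => Dx.
  by move: nDx; rewrite mem_set.
have Gy : fubini_G mu g = (fun y => (Rintegral mu D (fun x => h (x, y)))%:E) \_ D.
  apply/funext => y; rewrite /fubini_G patchE; case: ifPn => [/set_mem Dy|nDy].
    transitivity (\int[mu]_x ((EFin \o (fun x => h (x, y))) \_ D) x)%E.
      by apply: eq_integral => x _; rewrite gy.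
    by rewrite -integral_mkcond /Rintegral fineK//; exact: integrable_fin_num (hy y Dy).
  apply: integral0_eq => x _; rewrite gy0// => Dy.
  by move: nDy; rewrite mem_set.
have ig : (mu \x mu)%E.-integrable [set: measurableTypeR R * measurableTypeR R] g.
  apply/(integrable12ltyP mu mu mg).
  move: hfin; rewrite integral_mkcond; congr (_ < _)%E.
  apply: eq_integral => x _; rewrite patchE; case: ifPn => [/set_mem Dx|nDx].
    rewrite integral_mkcond; apply: eq_integral => y _; rewrite gx// !patchE.
    by case: ifP => // _; rewrite abse0.
  apply/esym; apply: integral0_eq => y _; rewrite gx0 ?abse0// => Dx.
  by move: nDx; rewrite mem_set.
have iF : mu.-integrable [set: R] (fubini_F mu g) by exact: integrable_fubini_F ig.
rewrite Fx in iF.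
have iG : mu.-integrable [set: R] (fubini_G mu g).
  apply/integrableP; split; first exact: (measurable_fubini_G ig).
  apply: le_lt_trans ((integrable21ltyP mu mu mg).1 ig).
  apply: ge0_le_integral => //.
  - by apply: measurableT_comp => //; exact: (measurable_fubini_G ig).
  - have mag : measurable_fun [set: measurableTypeR R * measurableTypeR R] (fun z => `|g z|%E).
      exact: measurableT_comp.
    have := @measurable_fun_fubini_tonelli_G _ _ _ _ _ mu _ mag (fun z => abse_ge0 (g z)).
    exact.
  - move=> y _; apply: le_abse_integral => //.
    exact: (measurable_fun_pair1 y mg).
rewrite Gy in iG.
split.
- by apply/(integrable_mkcond _ mD).
- by apply/(integrable_mkcond _ mD).
- have E : (\int[mu]_x fubini_F mu g x = \int[mu]_y fubini_G mu g y)%E.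
    exact: Fubini ig.
  rewrite Fx Gy -!integral_mkcond in E.
  by rewrite [LHS]/Rintegral E.
Qed.

(** Cutting [f] off in the second variable only turns the inner integral into one over the whole
    line, to which Tonelli's measurability applies. *)
Lemma measurable_integral01 (f : R * R -> \bar R) :
  measurable_fun [set: measurableTypeR R * measurableTypeR R] f ->
  (forall z, (0 <= f z)%E) ->
  measurable_fun D (fun x => (\int[mu]_(y in D) f (x, y))%E).
Proof.
move=> mf f0.
pose f' := fun z => if z.2 \in D then f z else 0%E.
have mf' : measurable_fun [set: measurableTypeR R * measurableTypeR R] f'.
  apply: measurable_fun_ifT => //.
  apply: (measurable_fun_bool true).
  rewrite setTI (_ : _ @^-1` _ = setT `*` D); first exact: measurableX.
  apply/seteqP; split => -[x y] H; first by split => //; exact: (set_mem H).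
  exact: (mem_set H.2).
have f'0 z : (0 <= f' z)%E by rewrite /f'; case: ifP.
have := @measurable_fun_fubini_tonelli_F _ _ _ _ _ mu f' mf' f'0.
rewrite (_ : fubini_F _ _ = (fun x => (\int[mu]_(y in D) f (x, y))%E)).
  by move=> H; exact: measurable_funS H.
apply/funext => x; rewrite /fubini_F [RHS]integral_mkcond; apply: eq_integral => y _.
by rewrite /f' patchE.
Qed.

Lemma cint_fubini01 (h : R * R -> R[i]) : cmeas [set: R * R] h ->
  (forall x, 0 < x < 1 -> cintegrable01 (fun y => h (x, y))) ->
  (forall y, 0 < y < 1 -> cintegrable01 (fun x => h (x, y))) ->
  (\int[mu]_(x in D) \int[mu]_(y in D) (normc (h (x, y)))%:E < +oo)%E ->
  [/\ cintegrable01 (fun x => cint01 (fun y => h (x, y))),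
      cintegrable01 (fun y => cint01 (fun x => h (x, y))) &
      cint01 (fun x => cint01 (fun y => h (x, y))) =
      cint01 (fun y => cint01 (fun x => h (x, y)))].
Proof.
move=> mh hx hy hfin.
have mn : measurable_fun [set: measurableTypeR R * measurableTypeR R] (fun z => (normc (h z))%:E).
  by apply/measurable_EFinP; exact: cmeas_normc mh.
have inD (P : R -> Prop) : (forall x, 0 < x < 1 -> P x) -> forall x, D x -> P x.
  by move=> hP x; rewrite /= in_itv/=; exact: hP.
have bnd (p : R[i] -> R) : (forall z, `|p z| <= normc z) ->
    measurable_fun [set: R * R] (fun z => p (h z)) ->
    (\int[mu]_(x in D) \int[mu]_(y in D) `|p (h (x, y))|%:E < +oo)%E.
  move=> hp mp; apply: le_lt_trans hfin.
  apply: ge0_le_integral => //.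
  - by move=> x _; exact: integral_ge0.
  - apply: (measurable_integral01 (f := fun z => (`|p (h z)|)%:E)) => //.
    by apply/measurable_EFinP; exact: measurableT_comp mp.
  - by apply: (measurable_integral01 (f := fun z => (normc (h z))%:E)) => // z; rewrite lee_fin normc_ge0.
  move=> x _; apply: ge0_le_integral => //.
  - apply/measurable_EFinP; apply: measurableT_comp => //.
    by have H := measurable_fun_pair2 x mp; exact: measurable_funS H.
  - by have H := measurable_fun_pair2 x mn; exact: measurable_funS H.
  - by move=> y _; rewrite lee_fin.
have [r1 r2 r3] := Rintegral_fubini01 mh.1 (inD _ (fun x hx' => (hx x hx').1))
  (inD _ (fun y hy' => (hy y hy').1)) (bnd _ (@normr_Re_le R) mh.1).
have [i1 i2 i3] := Rintegral_fubini01 mh.2 (inD _ (fun x hx' => (hx x hx').2))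
  (inD _ (fun y hy' => (hy y hy').2)) (bnd _ (@normr_Im_le R) mh.2).
split; [exact: (conj r1 i1)|exact: (conj r2 i2)|].
by rewrite /cint01 /=; congr Complex; [exact: r3|exact: i3].
Qed.

End fubini01.

(** * Beta transform of an entire power series *)

Section beta_transform.
Variable R : realType.
Local Notation mu := (@lebesgue_measure R).
Local Notation D := (`]0, 1[%classic : set R).

Let mD : measurable (D : set (measurableTypeR R)).
Proof. exact: measurable_itv. Qed.

(** The constant is doubled because real and imaginary parts are bounded separately; for a
    domination this is enough. *)
Lemma normc_cint01_le (f : R -> R[i]) (C : R) : cintegrable01 f ->
  (\int[mu]_(t in D) (normc (f t))%:E <= C%:E)%E -> normc (cint01 f) <= C + C.
Proof.
move=> /[dup] fi /cintegrable01P[mf nf] hC; have [fR fI] := fi.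
have hn : Rintegral mu D (fun t => normc (f t)) <= C.
  by rewrite -lee_fin /Rintegral fineK//; exact: integrable_fin_num nf.
apply: le_trans (normc_le_ReIm _) _; rewrite /cint01; apply: lerD; apply: le_trans hn.
- apply: le_trans (le_normr_Rintegral mD fR) _.
  apply: (le_Rintegral mD (integrable_norm fR) nf) => t _; exact: normr_Re_le.
- apply: le_trans (le_normr_Rintegral mD fI) _.
  apply: (le_Rintegral mD (integrable_norm fI) nf) => t _; exact: normr_Im_le.
Qed.

Section coefficients.
Variables (a : nat -> R[i]) (om w : R[i]).
Hypotheses (ea : entire_coef (@normc R \o a)).
Hypotheses (om0 : 0 < complex.Re om) (w0 : 0 < complex.Re w).

Definition beta_coef (m : nat) : R[i] :=
  a m * (pochhammer om m / pochhammer (om + w) m).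

Lemma beta_coefE m : cbeta om w * beta_coef m = a m * cbeta (om + m%:R) w.
Proof. by rewrite cbeta_pochhammer// /beta_coef; ring. Qed.

(** On the unit interval [t ^ m <= 1], so the absolute integral at [m = 0] bounds all the others. *)
Lemma cbeta_shift_bounded : exists C : R, forall m, normc (cbeta (om + m%:R) w) <= C.
Proof.
have ib := bweight_integrable om0 w0.
set C := fine (\int[mu]_(t in D) (bweight (complex.Re om) (complex.Re w) t)%:E)%E.
exists (C + C) => m.
have omm : 0 < complex.Re (om + m%:R) by rewrite cReD Re_nat ltr_wpDr.
apply: normc_cint01_le; first exact: cbeta_integrable.
rewrite /C fineK; last exact: integrable_fin_num ib.
apply: ge0_le_integral => //.
- by move=> t _; rewrite lee_fin normc_ge0.
- apply/measurable_EFinP; apply: cmeas_normc; apply: cmeasS; exact: cmeas_cpow_onem.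
- by apply/measurable_EFinP; have h := @measurable_bweight R (complex.Re om) (complex.Re w); exact: measurable_funS h.
move=> t tD; have t01 : 0 < t < 1 by move: tD; rewrite /= in_itv.
rewrite lee_fin normc_beta_integrand// cReD Re_nat /bweight.
rewrite ler_wpM2r ?powR_ge0//; case/andP: t01 => t0 t1.
by rewrite ger_powR ?t0 ?(ltW t1)// lerD2r lerDl.
Qed.

Lemma entire_beta_coef : entire_coef (@normc R \o beta_coef).
Proof.
have [C hC] := cbeta_shift_bounded.
move=> K K0; have [M hM] := ea K0.
exists (M * (C / normc (cbeta om w))) => m.
have b0 : 0 < normc (cbeta om w) by rewrite normc_gt0 cbeta_neq0.
(* As a quotient of beta integrals, the Pochhammer ratio is visibly bounded in [m], and boundedness
   of the terms is inherited from [a]. *)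
rewrite /=; have -> : beta_coef m = a m * (cbeta (om + m%:R) w / cbeta om w).
  by rewrite mulrA -beta_coefE mulrAC mulfV ?mul1r// cbeta_neq0.
rewrite ger0_norm ?normc_ge0// normcM normcM normcV mulrAC.
have := hM m; rewrite /= ger0_norm ?normc_ge0// => h.
rewrite ler_pM ?mulr_ge0 ?exprn_ge0 ?normc_ge0 ?invr_ge0 ?normc_ge0//.
by rewrite ler_pM2r ?invr_gt0 ?hC.
Qed.

Lemma beta_transform_entire (s : R) :
  cintegrable01 (fun r => cpow r (om - 1) * cpow (1 - r) (w - 1) * entire_fun a (r * s)) /\
  cint01 (fun r => cpow r (om - 1) * cpow (1 - r) (w - 1) * entire_fun a (r * s)) =
  cbeta om w * entire_fun beta_coef s.
Proof.
pose b r := cpow r (om - 1) * cpow (1 - r) (w - 1) : R[i].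
pose u m r := b r * (a m * (- (r * s)%:C) ^+ m).
have mb : cmeas [set: R] b by exact: cmeas_cpow_onem.
have mu_ m : cmeas D (u m).
  apply: cmeasS; apply: cmeasM => //; apply: cmeasM; first exact: cmeas_cst.
  have mr : cmeas [set: R] (fun r => - (r * s)%:C : R[i]).
    rewrite (_ : (fun r => _) = (fun r => (- 1) * (r * s)%:C)); last first.
      by apply/funext => r; rewrite mulN1r.
    apply: cmeasM; first exact: cmeas_cst.
    apply: cmeas_real; apply: measurable_funM; first exact: measurable_id.
    exact: measurable_cst.
  elim: m => [|m IH]; first exact: cmeas_cst.
  rewrite (_ : (fun r => _) = (fun r => - (r * s)%:C * (- (r * s)%:C) ^+ m)).
    exact: cmeasM.
  by apply/funext => r; rewrite exprS.
(* As [r < 1], the power of [r s] is bounded by that of [s], which separates [m] from [r] in the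
   majorant. *)
have hu m (r : R) : 0 < r < 1 -> normc (u m r) <=
    (normc (a m) * `|s| ^+ m) * bweight (complex.Re om) (complex.Re w) r.
  move=> r01; rewrite /u normcM normc_beta_integrand// mulrC.
  rewrite ler_wpM2r ?bweight_ge0// normcM normcX normcN normcR ler_wpM2l ?normc_ge0//.
  case/andP: r01 => r0 r1; rewrite normrM (gtr0_norm r0).
  by rewrite lerXn2r ?nnegrE ?mulr_ge0 ?(ltW r0)// ler_piMl// ltW.
have [||h1 h2 h3] := @cint01_csum R u (fun m => normc (a m) * `|s| ^+ m) _ mu_
   (bweight_integrable om0 w0) _ _ hu.
- by move=> m; rewrite mulr_ge0 ?normc_ge0 ?exprn_ge0.
- have := entire_coef_summable ea (normr_ge0 s).
  rewrite (_ : (fun m => _) = (fun m => normc (a m) * `|s| ^+ m))//.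
  by apply/funext => m /=; rewrite ger0_norm ?normc_ge0.
have e r : 0 < r < 1 -> csum (u ^~ r) = b r * entire_fun a (r * s).
  by move=> _; exact: (csumZ (b r) (@entire_fun_summable R a (r * s) ea)).
have eu m : cint01 (u m) = cbeta om w * (beta_coef m * (- s%:C) ^+ m).
  have omm : 0 < complex.Re (om + m%:R) by rewrite cReD Re_nat ltr_wpDr.
  rewrite mulrA beta_coefE mulrAC -cint01Z; last exact: cbeta_integrable.
  apply: eq_cint01 => r /andP[r0 r1].
  rewrite /u; have -> : (- (r * s)%:C) ^+ m = (r ^+ m)%:C * (- s%:C) ^+ m :> R[i].
    by rewrite rmorphM -mulrN exprMn rmorphXn.
  by rewrite /b addrAC cpowDn//; ring.
split; first exact: eq_cintegrable01 e h2.
rewrite -(eq_cint01 e) -(csum_to_csum h3).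
rewrite (_ : (fun m => cint01 (u m)) = (fun m => cbeta om w * (beta_coef m * (- s%:C) ^+ m))); last exact/funext.
exact: (csumZ _ (@entire_fun_summable R beta_coef s entire_beta_coef)).
Qed.

End coefficients.

End beta_transform.

(** * Exchange of the beta transform with the integral over [t] *)

Section mbeta_transform.
Variable R : realType.
Local Notation mu := (@lebesgue_measure R).
Local Notation D := (`]0, 1[%classic : set R).

Let mD : measurable (D : set (measurableTypeR R)).
Proof. exact: measurable_itv. Qed.

Variables (a : nat -> R[i]) (om w x y : R[i]).
Hypotheses (ea : entire_coef (@normc R \o a)).
Hypotheses (om0 : 0 < complex.Re om) (w0 : 0 < complex.Re w).
Hypotheses (x0 : 0 < complex.Re x) (y0 : 0 < complex.Re y).

Definition mbeta_kernel (c : nat -> R[i]) (n : nat) (r t : R) : R[i] :=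
  cpow t (x + n%:R - 1) * cpow (1 - t) (y - 1) * entire_fun c (r / (t * (1 - t))).

Hypothesis hI : forall n (r : R), 0 < r < 1 -> cintegrable01 (mbeta_kernel a n r).

Lemma normc_mbeta_kernel c n (r t : R) : 0 < t < 1 -> normc (mbeta_kernel c n r t) =
  bweight (complex.Re x + n%:R) (complex.Re y) t *
  normc (entire_fun c (r / (t * (1 - t)))).
Proof.
by move=> t01; rewrite /mbeta_kernel normcM normc_beta_integrand// cReD Re_nat.
Qed.

(** Uniformity in [n] comes from [t ^ n <= 1], which reduces to [n = 0]; uniformity in [r] is
    [kernel_bounded], whose reference integral is [hI] at [n = 0] and [r = 1/2]. *)
Lemma mbeta_kernel_bounded : exists2 C : R, 0 <= C & forall n (r : R), 0 < r < 1 ->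
  (\int[mu]_(t in D) (normc (mbeta_kernel a n r t))%:E <= C%:E)%E.
Proof.
have inD t : D t -> 0 < t < 1 by rewrite /= in_itv.
have h12 : 0 < (2^-1 : R) < 1 by rewrite invr_gt0 ltr0n invf_lt1// ltr1n.
have cN := entire_fun_normc_continuous ea.
have iN : mu.-integrable D (fun t => (bweight (complex.Re x) (complex.Re y) t *
    normc (entire_fun a (2^-1 / (t * (1 - t)))))%:E).
  have /cintegrable01P[_ h] := hI 0 h12.
  apply: eq_integrable h => // t /set_mem/inD t01.
  by rewrite normc_mbeta_kernel// addr0.
have [C hC] := kernel_bounded cN (fun s => normc_ge0 _) x0 y0 iN.
exists (Num.max C 0); first by rewrite le_max lexx orbT.
move=> n r r01.
apply: (@le_trans _ _ C%:E); last by rewrite lee_fin le_max lexx.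
apply: le_trans (hC r r01); apply: ge0_le_integral => //.
- by move=> t _; rewrite lee_fin normc_ge0.
- by apply/measurable_EFinP; apply: cmeas_normc; case/cintegrable01P: (hI n r01).
- apply/measurable_EFinP.
  by have h := kernel_measurable (complex.Re x) (complex.Re y) r cN; exact: measurable_funS h.
move=> t /inD t01; rewrite lee_fin normc_mbeta_kernel//.
rewrite ler_wpM2r ?normc_ge0// /bweight ler_wpM2r ?powR_ge0//.
case/andP: t01 => t0 t1.
by rewrite ger_powR ?t0 ?(ltW t1)// lerD2r lerDl.
Qed.

Lemma mbeta_fubini n :
  [/\ cintegrable01 (fun r => cpow r (om - 1) * cpow (1 - r) (w - 1) *
        cint01 (mbeta_kernel a n r)),
      cintegrable01 (mbeta_kernel (beta_coef a om w) n 1) &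
      cint01 (fun r => cpow r (om - 1) * cpow (1 - r) (w - 1) *
        cint01 (mbeta_kernel a n r)) =
      cbeta om w * cint01 (mbeta_kernel (beta_coef a om w) n 1)].
Proof.
pose b r := cpow r (om - 1) * cpow (1 - r) (w - 1) : R[i].
pose h (z : R * R) := b z.1 * mbeta_kernel a n z.1 z.2.
have B0 := cbeta_neq0 om0 w0.
pose k t := cpow t (x + n%:R - 1) * cpow (1 - t) (y - 1) : R[i].
have mh : cmeas [set: measurableTypeR R * measurableTypeR R] h.
  have m1 : measurable_fun [set: measurableTypeR R * measurableTypeR R] (@fst R R) by exact: measurable_fst.
  have m2 : measurable_fun [set: measurableTypeR R * measurableTypeR R] (@snd R R) by exact: measurable_snd.
  apply: cmeasM; first exact: (cmeas_comp (cmeas_cpow_onem (om - 1) (w - 1)) m1).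
  apply: cmeasM; first exact: (cmeas_comp (cmeas_cpow_onem (x + n%:R - 1) (y - 1)) m2).
  apply: (cmeas_comp (entire_fun_cmeas ea)).
  apply: measurable_funM => //.
  apply: (measurableT_comp (@measurable_invr R)); apply: measurable_funM => //.
  by apply: measurable_funB => //; exact: measurable_cst.
have hx r : 0 < r < 1 -> cintegrable01 (fun t => h (r, t)).
  by move=> r01; exact: (cintegrable01Z (b r) (hI n r01)).
have hE r t : h (r, t) = k t * (b r * entire_fun a (r * (1 / (t * (1 - t))))).
  by rewrite /h /mbeta_kernel /= mulrCA mul1r.
(* For fixed [t] the variable [r] only scales the argument of the entire function, so the inner
   integral is a beta transform evaluated at [s = 1 / (t (1 - t))]. *)
have hbt t := beta_transform_entire ea om0 w0 (1 / (t * (1 - t))).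
have hy t : 0 < t < 1 -> cintegrable01 (fun r => h (r, t)).
  move=> _; apply: (eq_cintegrable01 (fun r _ => esym (hE r t))).
  exact: (cintegrable01Z (k t) (hbt t).1).
have [C C0 hC] := mbeta_kernel_bounded.
have hfin : (\int[mu]_(r in D) \int[mu]_(t in D) (normc (h (r, t)))%:E < +oo)%E.
  have ib := bweight_integrable om0 w0.
  (* The inner integral over [t] is at most [C] times the weight in [r], which leaves a convergent
     real beta integral. *)
  pose g r := (C * bweight (complex.Re om) (complex.Re w) r)%:E.
  have ig : mu.-integrable D g by exact: (integrableZl mD C ib).
  apply: (@le_lt_trans _ _ (\int[mu]_(r in D) g r)%E); last exact: integrable_lty.
  have mn : measurable_fun [set: measurableTypeR R * measurableTypeR R] (fun z => (normc (h z))%:E).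
    by apply/measurable_EFinP; exact: cmeas_normc mh.
  apply: ge0_le_integral => //.
  - by move=> r _; apply: integral_ge0 => t _; rewrite lee_fin normc_ge0.
  - by apply: (measurable_integral01 (f := fun z => (normc (h z))%:E)) => // z;
      rewrite lee_fin normc_ge0.
  - exact: measurable_int ig.
  move=> r rD; have r01 : 0 < r < 1 by move: rD; rewrite /= in_itv.
  have -> : (\int[mu]_(t in D) (normc (h (r, t)))%:E =
      (normc (b r))%:E * \int[mu]_(t in D) (normc (mbeta_kernel a n r t))%:E)%E.
    rewrite -ge0_integralZl_EFin ?normc_ge0//.
    - by apply: eq_integral => t _; rewrite /h normcM EFinM.
    - by move=> t _; rewrite lee_fin normc_ge0.
    - by apply/measurable_EFinP; apply: cmeas_normc; case/cintegrable01P: (hI n r01).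
  have -> : g r = ((bweight (complex.Re om) (complex.Re w) r)%:E * C%:E)%E.
    by rewrite /g mulrC EFinM.
  rewrite [b r]/b normc_beta_integrand// lee_wpmul2l ?lee_fin ?bweight_ge0//.
  exact: hC.
have [f1 f2 f3] := cint_fubini01 mh hx hy hfin.
have e1 r : 0 < r < 1 ->
    cint01 (fun t => h (r, t)) = b r * cint01 (mbeta_kernel a n r).
  by move=> r01; exact: (cint01Z (b r) (hI n r01)).
have e2 t : cint01 (fun r => h (r, t)) = cbeta om w * mbeta_kernel (beta_coef a om w) n 1 t.
  rewrite (eq_cint01 (fun r _ => hE r t)) cint01Z; last exact: (hbt t).1.
  by rewrite (hbt t).2 mulrCA.
pose m := mbeta_kernel (beta_coef a om w) n 1.
(* Integrability of the extended kernel is not a hypothesis: Fubini provides it for the multiple by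
   [cbeta om w], which is nonzero. *)
have f2' : cintegrable01 m.
  have e t : 0 < t < 1 -> (cbeta om w)^-1 * cint01 (fun r => h (r, t)) = m t.
    by move=> _; rewrite e2 mulrA (mulVf B0) mul1r.
  exact: (@eq_cintegrable01 R (fun t => (cbeta om w)^-1 * cint01 (fun r => h (r, t))) m
    e (cintegrable01Z (cbeta om w)^-1 f2)).
pose b1 r := b r * cint01 (mbeta_kernel a n r).
split.
- exact: (@eq_cintegrable01 R (fun r => cint01 (fun t => h (r, t))) b1 e1 f1).
- exact: f2'.
rewrite -[LHS](@eq_cint01 R (fun r => cint01 (fun t => h (r, t))) b1 e1) f3.
rewrite (@eq_cint01 R _ (fun t => cbeta om w * m t) (fun t _ => e2 t)).
exact: (cint01Z (cbeta om w) f2').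
Qed.

End mbeta_transform.

(** * From the M-series to its coefficients, and the final exchange with the sum over [n] *)

Section mphi_transform.
Variable R : realType.

Definition mseries_coef (alpha beta : R[i]) (kappa mu : seq R[i]) (m : nat) : R[i] :=
  (\prod_(k <- kappa) pochhammer k m) / (\prod_(k <- mu) pochhammer k m) /
  cgamma (alpha * m%:R + beta).

Lemma mseries_termE alpha beta kappa mu (s : R) :
  mseries_term alpha beta kappa mu (- s%:C) =
  (fun m => mseries_coef alpha beta kappa mu m * (- s%:C) ^+ m).
Proof.
by apply/funext => m; rewrite /mseries_term /mseries_coef mulrA mulrAC.
Qed.

Lemma mseries_coef_rcons alpha beta kappa mu (om w : R[i]) :
  mseries_coef alpha beta (rcons kappa om) (rcons mu (om + w)) =
  beta_coef (mseries_coef alpha beta kappa mu) om w.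
Proof.
apply/funext => m; rewrite /mseries_coef /beta_coef !big_rcons/= invfM.
by ring.
Qed.

Lemma opp_real_div (r s : R) : - r%:C / s%:C = - (r / s)%:C :> R[i].
Proof. by rewrite mulNr rmorphM fmorphV. Qed.

Lemma mseries_definedE alpha beta kappa mu (s : R) :
  mseries_defined alpha beta kappa mu (- s%:C) =
  csummable (fun m => mseries_coef alpha beta kappa mu m * (- s%:C) ^+ m).
Proof. by rewrite /mseries_defined mseries_termE. Qed.

Lemma mbeta_integrandE alpha beta kappa mu (x y : R[i]) n (r : R) :
  mbeta_integrand alpha beta kappa mu (x + n%:R) y r%:C =
  mbeta_kernel x y (mseries_coef alpha beta kappa mu) n r.
Proof.
apply/funext => t; rewrite /mbeta_integrand /mbeta_kernel; congr (_ * _).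
by rewrite opp_real_div /Defs.mseries mseries_termE.
Qed.

Lemma mphi_defined_entire alpha beta kappa mu l2 l3 z (r : R) : 0 < r ->
  mphi_defined alpha beta kappa mu l2 l3 z r%:C ->
  entire_coef (@normc R \o mseries_coef alpha beta kappa mu).
Proof.
move=> r0 [h _]; have {h}[h _] := h 0%N.
apply: entire_coef_of_csummable => s s0.
(* With [t = 1 / (s / r + 2)] one has [r / (t (1 - t)) >= r / t = s + 2 r >= s]; the summand 2
   ensures [t < 1]. *)
have v0 : 0 < s / r + 2 by rewrite addr_gt0 ?divr_gt0.
have t01 : 0 < (s / r + 2)^-1 < 1.
  by rewrite invr_gt0 v0 invf_lt1// ltr_wpDl ?ltr1n// ltW// divr_gt0.
exists (r / ((s / r + 2)^-1 * (1 - (s / r + 2)^-1))).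
  set t := (s / r + 2)^-1 in t01 *.
  have [t0 t1] := andP t01.
  have d0 : 0 < t * (1 - t) by rewrite mulr_gt0 ?subr_gt0.
  rewrite ler_pdivlMr//; apply: (@le_trans _ _ (s * t)).
    by rewrite ler_pM2l// ler_piMr ?(ltW t0)// gerBl ltW.
  have : (s / r + 2) * t = 1 by rewrite /t mulfV ?gt_eqF.
  rewrite mulrDl => e; have : s / r * t <= 1 by rewrite -e lerDl mulr_ge0// ltW.
  by rewrite mulrAC ler_pdivrMr// mul1r.
by rewrite -mseries_definedE -opp_real_div; exact: h.
Qed.

End mphi_transform.

Unset Implicit Arguments.

Theorem theorem4p6 (R : realType) (p q : nat)
    (kappa : p.-tuple R[i]) (mu : q.-tuple R[i])
    (alpha beta l2 l3 omega w z : R[i])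
    (hkappa : forall (i : 'I_p) (k : nat), tnth kappa i <> - k%:R)
    (hmu : forall (j : 'I_q) (k : nat), tnth mu j <> - k%:R)
    (halpha : 0 < complex.Re alpha)
    (hl2 : 0 < complex.Re l2)
    (hl3 : complex.Re l2 < complex.Re l3)
    (homega : 0 < complex.Re omega)
    (hw : 0 < complex.Re w)
    (hdef : forall rho : R, 0 < rho < 1 ->
       mphi_defined alpha beta kappa mu l2 l3 z rho%:C) :
  [/\ cintegrable01 (fun rho : R =>
        cpow rho (omega - 1) * cpow (1 - rho) (w - 1)
        * mphi alpha beta kappa mu l2 l3 z rho%:C),
      mphi_defined alpha beta (rcons kappa omega) (rcons mu (omega + w))
        l2 l3 z 1
    & cint01 (fun rho : R =>
        cpow rho (omega - 1) * cpow (1 - rho) (w - 1)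
        * mphi alpha beta kappa mu l2 l3 z rho%:C)
      = cbeta omega w
        * mphi alpha beta (rcons kappa omega) (rcons mu (omega + w))
            l2 l3 z 1].
Proof.
pose a := mseries_coef alpha beta kappa mu.
set ext1 := rcons kappa omega; set ext2 := rcons mu (omega + w).
pose y := l3 - l2; have y0 : 0 < complex.Re y by rewrite cReD cReN subr_gt0.
have h12 : 0 < (2^-1 : R) < 1 by rewrite invr_gt0 ltr0n invf_lt1// ltr1n.
have ea : entire_coef (@normc R \o a).
  by apply: (mphi_defined_entire _ (hdef _ h12)); case/andP: h12.
have hI n (r : R) : 0 < r < 1 -> cintegrable01 (mbeta_kernel l2 y a n r).
  by move=> /hdef[/(_ n)[_ +] _]; rewrite mbeta_integrandE.
have B1 := cbeta_neq0 homega hw.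
have B2 := cbeta_neq0 hl2 y0.
have [C C0 hC] := mbeta_kernel_bounded ea hl2 y0 hI.
pose b r := cpow r (omega - 1) * cpow (1 - r) (w - 1) : R[i].
pose K n := cint01 (mbeta_kernel l2 y (beta_coef a omega w) n 1).
pose e n := z ^+ n / n`!%:R : R[i].
pose d n := (cbeta l2 y)^-1 * e n.
pose u n r := d n * (b r * cint01 (mbeta_kernel l2 y a n r)).
have tE (r : R) n : mphi_term alpha beta kappa mu l2 l3 z r%:C n =
    d n * cint01 (mbeta_kernel l2 y a n r).
  rewrite /mphi_term /mbeta mbeta_integrandE -/y -/a /d /e.
  by rewrite -mulrA mulrC.
have xE n : mphi_term alpha beta ext1 ext2 l2 l3 z 1 n = d n * K n.
  rewrite /mphi_term /mbeta -(rmorph1 (real_complex R)) mbeta_integrandE mseries_coef_rcons.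
  by rewrite -/y -/a /d /e -mulrA mulrC.
have F n := mbeta_fubini ea homega hw hl2 y0 hI n.
have mu_ n : cmeas (`]0%R, 1%R[%classic : set (measurableTypeR R)) (u n).
  apply: cmeasM; first exact: cmeas_cst.
  by have [/cintegrable01P[m1 _] _ _] := F n.
(* Since [C] bounds the integrals over [t] uniformly in [n] and [r], the dependence on [n] is just
   the exponential series at [|z|], while [g] below carries the beta weight. *)
pose c n := normc z ^+ n / n`!%:R : R.
have c0 n : 0 <= c n by rewrite divr_ge0 ?exprn_ge0 ?normc_ge0.
have cc : cvgn (series c) by exact: is_cvg_series_exp_coeff.
pose g r := (C + C) / normc (cbeta l2 y) * bweight (complex.Re omega) (complex.Re w) r.
have ig : (@lebesgue_measure R).-integrable `]0, 1[ (EFin \o g).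
  exact: (integrableZl _ _ (bweight_integrable homega hw)).
have hu n (r : R) : 0 < r < 1 -> normc (u n r) <= c n * g r.
  move=> r01; rewrite /u normcM (normcM (b r)) [b r]/b normc_beta_integrand//.
  rewrite /d normcM normcV.
  have -> : normc (e n) = c n by rewrite /e normcM normcV normc_natr normcX.
  have hk := normc_cint01_le (hI n r r01) (hC n r r01).
  have -> : c n * g r = (normc (cbeta l2 y))^-1 * c n *
      (bweight (complex.Re omega) (complex.Re w) r * (C + C)) by rewrite /g; ring.
  rewrite ler_wpM2l//; first by apply: mulr_ge0 (c0 n); rewrite invr_ge0 normc_ge0.
  by rewrite ler_wpM2l ?bweight_ge0.
have [_ s2 s3] := cint01_csum mu_ ig c0 cc hu.
have uE n : cint01 (u n) = cbeta omega w * (d n * K n).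
  have [F1 _ F3] := F n.
  by rewrite [LHS](cint01Z (d n) F1) F3 mulrCA.
have sE (r : R) : 0 < r < 1 ->
    csum (u ^~ r) = b r * mphi alpha beta kappa mu l2 l3 z r%:C.
  move=> r01; have [_ hs] := hdef r r01; rewrite /mphi -(csumZ (b r) hs).
  by congr csum; apply/funext => n; rewrite tE mulrCA.
(* The termwise integrals are [cbeta omega w] times the terms of the extended series; dividing by
   this nonzero factor yields its convergence and its sum at once. *)
have xs : csum_to (mphi_term alpha beta ext1 ext2 l2 l3 z 1)
    ((cbeta omega w)^-1 * cint01 (fun r => csum (u ^~ r))).
  rewrite (_ : mphi_term _ _ _ _ _ _ _ _ = (fun n => (cbeta omega w)^-1 * cint01 (u n))).
    exact: csum_toZ.
  by apply/funext => n; rewrite xE uE mulrA (mulVf B1) mul1r.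
split.
- exact: eq_cintegrable01 sE s2.
- split; last exact: csum_to_summable xs.
  move=> n; rewrite /mbeta_defined -(rmorph1 (real_complex R)) mbeta_integrandE.
  rewrite mseries_coef_rcons; split; last by have [] := F n.
  move=> t _; rewrite opp_real_div mseries_definedE mseries_coef_rcons.
  by apply: entire_fun_summable; exact: entire_beta_coef.
by rewrite -(eq_cint01 sE) /mphi (csum_to_csum xs) mulrA (mulfV B1) mul1r.
Qed.
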